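(* Let $n,m\ge 0$ be integers, and let $h_{n,m}(b_1,b_2)$ be the function of $t$ defined in the context (considered where the corresponding polynomial $U_{n,m}(b_1,b_2)$ does not vanish). (i) For $b_1,b_2\in\mathbb C$, the function $h_{0,m}(b_1,b_2)$ satisfies the Painlevé–Okamoto equation $E_{VI}(b_1,b_2,m+\frac12,0)$. (ii) $h_{1,m}(0,m+1)=-(2t-1)(m+1)^2/2$, and this function satisfies the equation $E_{VI}(0,m+1,b_3,b_4)$ for all $b_3,b_4\in\mathbb C$. (iii) For $b_2\in\mathbb C$, the function $h_{n,m}(0,b_2)$ satisfies the equation $E_{VI}\left(0,b_2,\frac n2,\frac{n+2m+1}{2}\right)$.
   Context: Painlevé–Okamoto equation $E_{VI}(b_1,b_2,b_3,b_4)$ for a function $h=h(t)$: $$\frac{dh}{dt}\left[t(t-1)\frac{d^2h}{dt^2}\right]^2+\left[\frac{dh}{dt}\left\{2h-(2t-1)\frac{dh}{dt}\right\}+b_1b_2b_3b_4\right]^2=\prod_{k=1}^4\left(\frac{dh}{dt}+b_k^2\right).$$ For nonnegative integers $n,m$ put $[n;m]=\{1,2,\ldots,n,n+2,n+4,\ldots,n+2m\}$. For a finite set $I$ of positive integers, $|I|$ denotes the SUM of its elements. For $I\subset[n;m]$ put $$\mathbf d_{n,m}(I)=\prod_{i\in I,\ j\in[n;m]\setminus I}\left|\frac{i+j}{i-j}\right|,\qquad \mathbf c(I)=\sum_{i\in I,\ i>n}\frac{i-n}{2}.$$ For parameters $a,b$ put $\bar a_k=a+(k-1)^2$, $\bar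 b_k=b+(k-1)^2$, $a_{2k}=\bar a_2\bar a_4\cdots\bar a_{2k}$, $a_{2k+1}=\bar a_1\bar a_3\cdots\bar a_{2k+1}$, similarly for $b_{2k},b_{2k+1}$; $a_I=\prod_{i\in I}a_i$, $b_I=\prod_{i\in I}b_i$. Define $$U_{n,m}(z,w;a,b)=\sum_{I\subset[n;m]}\mathbf d_{n,m}(I)\,(-1)^{\mathbf c(I)}\,a_I\,b_{[n;m]\setminus I}\,z^{|I|}\,w^{|[n;m]\setminus I|},$$ and $U_{n,m}(b_1,b_2):=U_{n,m}(z,w;-4b_1^2,-4b_2^2)$. The variables are functions of $t$ (take $t>1$ with positive square roots): $v=\sqrt{\frac{t}{t-1}}+\sqrt{\frac{t-1}{t}}$, $z=\frac12(v-2)^{1/2}$, $w=\frac12(v+2)^{1/2}$ (equivalently $v=e^x+e^{-x}$ with $e^x=\sqrt{t/(t-1)}$). Put $$h_0(b_1,b_2)=\frac14\left\{b_1^2\left(\sqrt t-\sqrt{t-1}\right)^2+b_2^2\left(\sqrt t+\sqrt{t-1}\right)^2\right\},$$ $$h_{n,m}(b_1,b_2)=t(t-1)\frac{d}{dt}\log U_{n,m}(b_1,b_2)-h_0(b_1,b_2).$$ *)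

(* Defs.v *)
From HB Require Import structures.
From mathcomp Require Import all_boot all_order all_algebra finmap.
From mathcomp Require Import complex.
From mathcomp Require Import all_classical all_reals all_analysis.

Set Implicit Arguments.
Unset Strict Implicit.
Unset Printing Implicit Defensive.

Import Order.TTheory GRing.Theory Num.Theory.
Import numFieldNormedType.Exports.

Local Open Scope fset_scope.
Local Open Scope ring_scope.
Local Open Scope complex_scope.

Section Polynomials.
Variable F : numFieldType.

(* [n;m] = {1, 2, ..., n, n+2, n+4, ..., n+2m} *)
Definition bracket (n m : nat) : {fset nat} :=
  [fset i in iota 1 n ++ [seq (n + 2 * k)%N | k <- iota 1 m]].

(* |I|, the sum (not the number) of the elements of I *)
Definition weight (I : {fset nat}) : nat := (\sum_(i <- I) i)%N.

Definition dcoef (n m : nat) (I : {fset nat}) : F :=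
  \prod_(i <- I) \prod_(j <- bracket n m `\` I)
    `| (i%:R + j%:R) / (i%:R - j%:R) |.

(* For I included in [n;m] the halving is exact: the elements above n are
   the n + 2k. *)
Definition cexp (n : nat) (I : {fset nat}) : nat :=
  (\sum_(i <- I | (n < i)%N) (i - n)./2)%N.

(* a_i is the product of the a + (k-1)^2 over 1 <= k <= i, k = i mod 2. *)
Definition pcoef (a : F) (i : nat) : F :=
  \prod_(1 <= k < i.+1 | odd k == odd i) (a + (k%:R - 1) ^+ 2).

Definition pcoefs (a : F) (I : {fset nat}) : F := \prod_(i <- I) pcoef a i.

Definition Upoly (n m : nat) (z w a b : F) : F :=
  \sum_(I <- fpowerset (bracket n m))
    dcoef n m I * (-1) ^+ cexp n I * pcoefs a I * pcoefs b (bracket n m `\` I)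
      * z ^+ weight I * w ^+ weight (bracket n m `\` I).

End Polynomials.

Section PainleveOkamoto.
Variable R : realType.

(* Derivatives of complex-valued functions of a real variable are taken on
   real and imaginary parts. *)
Definition cderivable (f : R -> R[i]) (t : R) : Prop :=
  derivable (fun x => complex.Re (f x)) t 1 /\
  derivable (fun x => complex.Im (f x)) t 1.

Definition cderive (f : R -> R[i]) (t : R) : R[i] :=
  derive1 (fun x => complex.Re (f x)) t +i* derive1 (fun x => complex.Im (f x)) t.

(* h is a solution of E_VI(b1,b2,b3,b4) on D, a set meant to be open: h is
   twice differentiable at every point of D and the equation holds there. *)
Definition solves_EVI (b1 b2 b3 b4 : R[i]) (D : set R) (h : R -> R[i]) : Prop :=
  forall t : R, D t ->
    let h' := cderive h t in
    let h'' := cderive (cderive h) t in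
    [/\ cderivable h t,
        cderivable (cderive h) t
      & h' * ((t * (t - 1))%:C * h'') ^+ 2
        + (h' * (2 * h t - (2 * t - 1)%:C * h') + b1 * b2 * b3 * b4) ^+ 2
        = (h' + b1 ^+ 2) * (h' + b2 ^+ 2) * (h' + b3 ^+ 2) * (h' + b4 ^+ 2)].

Definition vfun (t : R) : R :=
  Num.sqrt (t / (t - 1)) + Num.sqrt ((t - 1) / t).
Definition zfun (t : R) : R := 2^-1 * Num.sqrt (vfun t - 2).
Definition wfun (t : R) : R := 2^-1 * Num.sqrt (vfun t + 2).

Definition Ufun (n m : nat) (b1 b2 : R[i]) (t : R) : R[i] :=
  Upoly n m (zfun t)%:C (wfun t)%:C (- 4 * b1 ^+ 2) (- 4 * b2 ^+ 2).

Definition h0fun (b1 b2 : R[i]) (t : R) : R[i] :=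
  4^-1 * (b1 ^+ 2 * ((Num.sqrt t - Num.sqrt (t - 1)) ^+ 2)%:C
          + b2 ^+ 2 * ((Num.sqrt t + Num.sqrt (t - 1)) ^+ 2)%:C).

(* The logarithmic derivative of the complex-valued U is U'/U, which does not
   depend on a branch of the logarithm. *)
Definition hfun (n m : nat) (b1 b2 : R[i]) (t : R) : R[i] :=
  (t * (t - 1))%:C * (cderive (Ufun n m b1 b2) t / Ufun n m b1 b2 t)
  - h0fun b1 b2 t.

Definition hdom (n m : nat) (b1 b2 : R[i]) : set R :=
  [set t | 1 < t /\ Ufun n m b1 b2 t != 0]%classic.

End PainleveOkamoto.

(* Main.v *)
(* Put t = cosh^2(theta/2) and q = e^theta = (sqrt t + sqrt (t-1))^2.  Then
   z^2 = 1/(q^2-1), w^2 = q^2/(q^2-1), and the sum defining U_{0,m} is, up to a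
   power of q^2-1, the expansion of the Wronskian tau_m = W(f_1, ..., f_m) in
   theta, where f_k = B_k q^k - A_k q^-k, A_k = prod_{l<=k} (a + (2l-1)^2) and
   B_k is the same product for b.  The operator
   q(4D^2+4D+1+b) + q^-1(4D^2-4D+1+a), D = d/dtheta, sends f_k to
   f_{k+1} + y_k f_{k-1}; letting it act as a derivation on the Wronskian and
   applying the Desnanot-Jacobi identity gives the Toda equation
   tau_{m+1} tau_{m-1} = c_m (q-1/q) tau_m^2 (4h_m' + (2m+1)^2).
   The sigma form of Painleve VI then propagates along m as a Backlund chain:
   for fixed h_m and h_{m+1}-h_m, the derivatives h_m' and h_{m+1}' are the two
   roots of one quadratic equation.
   If a = 0 only the even elements of [n;m] contribute.  If there are N of them
   and M odd ones, the odd ones replace a by -4M^2, so that h_{n,m}(0,b_2) equals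
   h_{0,N}(M,b_2). *)
Require Import Defs.
From HB Require Import structures.
From mathcomp Require Import all_boot all_order all_algebra finmap.
From mathcomp Require Import ring zify.

Set Implicit Arguments.
Unset Strict Implicit.
Unset Printing Implicit Defensive.

Import Order.TTheory GRing.Theory Num.Theory.

Local Open Scope ring_scope.

(** * Differential fields and the Backlund chain *)

(** The chain divides by every [tau n], and for special a and b some of these vanish identically, so
    the induction cannot be run at the given parameters. It is run instead in an abstract
    differential field in which all [tau n] are nonzero. That field is realised as the fractions of
    [{poly S}], with q the variable and D = q d/dq. The conclusion is multiplied out into an
    identity between polynomials, and only this identity is specialised to the actual a and b.
    Functions of t enter last, when q is replaced by its value at t. The sigma form alone does not
    propagate along m: the induction carries three relations between h_m and the difference h_{m-1}
    - h_m, and eliminating the difference gives the sigma form. In (i) and (iii) one parameter of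
    the equation is 0, so both sides of E_VI contain the factor h'. What is proved is the equation
    with this factor removed. Part (ii) needs only the explicit linear h, for which both sides
    vanish whatever b_3 and b_4 are. *)

Record derivation (L : nzRingType) (D : L -> L) : Prop := Derivation {
  drvD : forall x y, D (x + y) = D x + D y;
  drvM : forall x y, D (x * y) = D x * y + x * D y }.

Section DerivationTheory.
Variables (L : fieldType) (D : L -> L).
Hypothesis dD : derivation D.
Let DD := drvD dD.
Let DM := drvM dD.

Lemma drv0 : D 0 = 0.
Proof. by apply: (addrI (D 0)); rewrite -DD !addr0. Qed.

Lemma drv1 : D 1 = 0.
Proof. by apply: (addrI (D 1)); rewrite addr0 -{3}[1]mulr1 DM mulr1 mul1r. Qed.

Lemma drvN x : D (- x) = - D x.
Proof. by apply: (addrI (D x)); rewrite -DD !subrr drv0. Qed.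

Lemma drvB x y : D (x - y) = D x - D y.
Proof. by rewrite DD drvN. Qed.

Lemma drv_nat n : D n%:R = 0.
Proof. by elim: n => [|n IH]; rewrite ?drv0 // -natr1 DD IH drv1 addr0. Qed.

Lemma drvX x n : D (x ^+ n) = n%:R * x ^+ n.-1 * D x.
Proof.
elim: n => [|[|n] IH]; first by rewrite drv1 !mul0r.
  by rewrite !expr1 !mul1r.
by rewrite exprS DM IH /= -[n.+2%:R]natr1 [x ^+ n.+1]exprS; ring.
Qed.

Lemma drvV x : D x^-1 = - D x / x ^+ 2.
Proof.
have [->|x0] := eqVneq x 0; first by rewrite invr0 drv0 oppr0 mul0r.
have := congr1 D (mulfV x0); rewrite DM drv1 => e.
apply: (mulfI x0); move/eqP: e; rewrite addrC addr_eq0 => /eqP ->.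
by field.
Qed.

Lemma drv_prod n (F : 'I_n -> L) :
  D (\prod_i F i) = \sum_i \prod_j (if j == i then D (F j) else F j).
Proof.
elim: n F => [|n IH] F; first by rewrite !big_ord0 drv1.
rewrite big_ord_recl DM IH big_ord_recl big_ord_recl /=; congr (_ * _ + _).
rewrite big_distrr; apply: eq_bigr => i _; rewrite big_ord_recl /=; congr (_ * _).
Qed.

Lemma drv_sum I (s : seq I) (P : pred I) (F : I -> L) :
  D (\sum_(i <- s | P i) F i) = \sum_(i <- s | P i) D (F i).
Proof. exact: (big_morph D DD drv0). Qed.

Section Chain.
Variables (q a b : L).
Hypotheses (q0 : q != 0) (p0 : q - q^-1 != 0) (n2 : 2 != 0 :> L).
Hypotheses (Dq : D q = q) (Da : D a = 0) (Db : D b = 0).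

Let p := q - q^-1.
Let r := q + q^-1.

Lemma drvVq : D q^-1 = - q^-1.
Proof. by rewrite drvV Dq; field. Qed.

Lemma drv_p : D p = r.
Proof. by rewrite /p /r drvB drvVq Dq opprK. Qed.

Lemma drv_r : D r = p.
Proof. by rewrite /p /r DD drvVq Dq. Qed.

Definition xi eta := D eta / p.
Definition upsilon eta := p * D (xi eta).
Definition mu eta := eta - r * xi eta.

(* [eta], [xi eta], [upsilon eta], [mu eta] stand for 16h, 4h', 16t(t-1)h'' and
   8(2h-(2t-1)h'), K is 2m+1, and z/16 is the previous solution minus h. *)
Definition backlund (K : nat) (eta z : L) :=
  [/\ 2 * (upsilon eta - K%:R * mu eta) = (xi eta + K%:R ^+ 2) * z,
      4 * (p * D z) + 8 * p ^+ 2 * xi eta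
        = - z ^+ 2 + 4 * K%:R * r * z + 8 * eta * r - 16 * (a + b)
    & (xi eta + K%:R ^+ 2) * z ^+ 2 + 4 * K%:R * z * mu eta + 4 * mu eta ^+ 2
        = 16 * (xi eta - a) * (xi eta - b)].

Let n4 : 4 != 0 :> L.
Proof. by rewrite (natrM _ 2 2) mulf_neq0. Qed.

(** Multiplying the third relation by w/4, where w = xi + K^2, turns its left side into (w z/2 + K
    mu)^2 + xi mu^2, and by the first relation the bracket is upsilon. *)
Lemma backlund_sigma K eta z : backlund K eta z ->
  upsilon eta ^+ 2 + xi eta * mu eta ^+ 2
    = 4 * (xi eta - a) * (xi eta - b) * (xi eta + K%:R ^+ 2).
Proof.
case; set u := upsilon eta; set x := xi eta; set m := mu eta => I1 _ I3.
have -> : u = K%:R * m + (x + K%:R ^+ 2) * z / 2 by rewrite -I1; field.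
apply: (mulfI n4); transitivity ((x + K%:R ^+ 2) * (16 * (x - a) * (x - b))).
  by rewrite -I3; field.
by ring.
Qed.

(** The relation on [z + zp] makes [zp] satisfy the same three relations with K replaced by -K;
    these are [I1'], [I2'] and [I3'] below. Seen from the new solution [eta + zp], the old one lies
    at the difference [- zp]. *)
Lemma backlund_step K eta z zp : backlund K eta z ->
    xi eta + K%:R ^+ 2 != 0 ->
    (xi eta + K%:R ^+ 2) * (z + zp) = 4 * upsilon eta ->
  backlund K.+2 (eta + zp) (- zp).
Proof.
move=> B; have E' := backlund_sigma B; move: B E'.
case; set u := upsilon eta; set x := xi eta; set m := mu eta.
set k := K%:R; set w := x + k ^+ 2 => I1 I2 I3 E' w0 T.
have em : m = eta - r * x by [].
have ee : D eta = p * x by rewrite /x /xi mulrC divfK.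
have pDx : p * D x = u by [].
have Dk : D k = 0 by rewrite drv_nat.
have k2 : K.+2%:R = k + 2 by rewrite -addn2 natrD.
have ew : w = x + k ^+ 2 by [].
clearbody w u m x k.
have pDm : p * D m = - r * u by rewrite em drvB ee DM drv_r -pDx; ring.
have Dw : p * D w = u.
  by rewrite ew DD [D (k ^+ 2)]drvX Dk mulr0 addr0.
have I1' : 2 * (u + k * m) = w * zp.
  have : w * zp = 4 * u - w * z by rewrite -T; ring.
  by rewrite -I1 => ->; ring.
(* [I1] and [I1'] are both differentiated; D u cancels in the difference of the results. *)
have dz : p * D zp = p * D z + (z ^+ 2 - zp ^+ 2) / 4 - k * r * (z + zp).
  have e1 := congr1 (fun y => p * D y) I1; have e2 := congr1 (fun y => p * D y) I1'.
  rewrite /= !(DM, drvB) Dk (drv_nat 2) !mul0r !add0r in e1.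
  rewrite /= DM [D (u + _)]DD !DM Dk (drv_nat 2) !mul0r !add0r in e2.
  have {e1} e1 : w * (p * D z) = 2 * (p * D u - k * (p * D m)) - (p * D w) * z.
    by transitivity (p * (D w * z + w * D z) - (p * D w) * z); [ring | rewrite -e1; ring].
  have {e2} e2 : w * (p * D zp) = 2 * (p * D u + k * (p * D m)) - (p * D w) * zp.
    by transitivity (p * (D w * zp + w * D zp) - (p * D w) * zp); [ring | rewrite -e2; ring].
  apply: (mulfI w0); rewrite mulrBr mulrDr e1 e2 Dw pDm.
  have -> : u = w * (z + zp) / 4 by rewrite T; field.
  by field.
have I2' : 4 * (p * D zp) + 8 * p ^+ 2 * x
        = - zp ^+ 2 - 4 * k * r * zp + 8 * eta * r - 16 * (a + b).
  transitivity (4 * (p * D z) + 8 * p ^+ 2 * x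
     + z ^+ 2 - zp ^+ 2 - 4 * k * r * (z + zp)); first by rewrite dz; field.
  by rewrite I2; ring.
have I3' : w * zp ^+ 2 - 4 * k * zp * m + 4 * m ^+ 2 = 16 * (x - a) * (x - b).
  apply: (mulfI w0); transitivity (4 * (4 * (x - a) * (x - b) * w)); last by ring.
  rewrite -E'.
  have -> : u = w * zp / 2 - k * m by rewrite -I1'; field.
  by rewrite ew; field.
set xp := xi (eta + zp); set up := upsilon (eta + zp).
have exp : p * D zp = p ^+ 2 * (xp - x).
  by rewrite /xp /xi DD ee; field.
(* [I3'] is a quadratic equation in x with leading coefficient 4 r^2 - 16 = 4 p^2. Through [exp],
   [I2'] says that xp is its other root: [J] is the formula for the sum of the roots. *)
have J : 4 * p ^+ 2 * (x + xp)
        = - zp ^+ 2 - 4 * k * r * zp + 8 * eta * r - 16 * (a + b).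
  by rewrite -I2' exp; ring.
have r2 : r ^+ 2 = p ^+ 2 + 4 by rewrite /r /p; field.
have emp : mu (eta + zp) = eta + zp - r * xp by [].
split; rewrite -?/xp -?/up ?k2 ?emp.
(* As [up] is p D xp, the first relation comes from differentiating [J] and solving for [up]. *)
- have p20 : 4 * p ^+ 2 != 0 by rewrite mulf_neq0 ?expf_neq0.
  have eu : u = w * zp / 2 - k * m by rewrite -I1'; field.
  have dl : D (4 * p ^+ 2 * (x + xp))
      = 8 * p * r * (x + xp) + 4 * p ^+ 2 * (D x + D xp).
    rewrite DM [D (x + xp)]DD DM [D (p ^+ 2)]drvX (drv_nat 4) drv_p /=.
    by ring.
  have dr : D (- zp ^+ 2 - 4 * k * r * zp + 8 * eta * r - 16 * (a + b))
      = - 2 * zp * D zp - 4 * k * (p * zp + r * D zp)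
        + 8 * (p * x * r + eta * p).
    rewrite drvB [D (16 * _)]DM [D (a + b)]DD (drv_nat 16) Da Db.
    rewrite [D (_ + 8 * eta * r)]DD drvB drvN [D (zp ^+ 2)]drvX.
    rewrite [D (8 * eta * r)]DM [D (8 * eta)]DM (drv_nat 8) ee drv_r.
    rewrite [D (4 * k * r * zp)]DM [D (4 * k * r)]DM [D (4 * k)]DM.
    rewrite (drv_nat 4) Dk drv_r /=.
    by ring.
  have J' : 8 * p ^+ 2 * r * (x + xp) + 4 * p ^+ 2 * (u + up)
     = - 2 * zp * (p * D zp) - 4 * k * (p ^+ 2 * zp + r * (p * D zp))
       + 8 * (p ^+ 2 * x * r + eta * p ^+ 2).
    have -> : up = p * D xp by [].
    rewrite -pDx; transitivity (p * D (4 * p ^+ 2 * (x + xp))).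
      by rewrite dl; ring.
    by rewrite J dr; ring.
  apply: (mulfI p20); rewrite exp in J'.
  have -> : up = (8 * p ^+ 2 * r * (x + xp) + 4 * p ^+ 2 * (u + up)
      - 8 * p ^+ 2 * r * (x + xp)) / (4 * p ^+ 2) - u.
    by field; rewrite n4 p0.
  rewrite J' eu em ew; field.
  by rewrite n2 n4 p0.
- rewrite drvN mulrN exp; transitivity (4 * p ^+ 2 * (x + xp)); first by ring.
  by rewrite J; ring.
(* Replacing K by K + 2 and eta by eta + zp leaves the quadratic of [I3'] unchanged except that x
   becomes xp, so the claim is that xp is a root too. *)
- apply/eqP; rewrite -subr_eq0; apply/eqP.
  transitivity (w * zp ^+ 2 - 4 * k * zp * m + 4 * m ^+ 2 - 16 * (x - a) * (x - b)
    + (xp - x) * (4 * p ^+ 2 * (x + xp)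
      - (- zp ^+ 2 - 4 * k * r * zp + 8 * eta * r - 16 * (a + b)))
    ); last by rewrite I3' J !subrr mulr0 addr0.
  by rewrite em ew; ring: r2.
Qed.
End Chain.
End DerivationTheory.

(** * Wronskians *)

Section TraceCofactor.
Variables (R : comNzRingType) (n : nat).
Implicit Types M N C : 'M[R]_n.

(* The derivative of the determinant at M in the direction N: it can be computed
   along rows and along columns. *)
Definition ddet M N := \sum_i \sum_j N i j * cofactor M i j.

Lemma ddetE M N : ddet M N = \tr (N *m \adj M).
Proof.
apply: eq_bigr => i _; rewrite mxE; apply: eq_bigr => j _.
by rewrite !mxE.
Qed.

Lemma ddetD M N1 N2 : ddet M (N1 + N2) = ddet M N1 + ddet M N2.
Proof. by rewrite !ddetE mulmxDl mxtraceD. Qed.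

Lemma ddetZ M c N : ddet M (c *: N) = c * ddet M N.
Proof. by rewrite !ddetE -scalemxAl mxtraceZ. Qed.

(** Recombining the rows of M, or its columns in the next lemma, changes the determinant to first
    order only through a trace. This is what makes the ladder operator computable on a Wronskian. *)
Lemma ddet_mull M C : ddet M (C *m M) = \tr C * \det M.
Proof. by rewrite ddetE -mulmxA mul_mx_adj mul_mx_scalar mxtraceZ mulrC. Qed.

Lemma ddet_mulr M C : ddet M (M *m C) = \tr C * \det M.
Proof.
by rewrite ddetE -mulmxA mxtrace_mulC -mulmxA mul_adj_mx mul_mx_scalar mxtraceZ mulrC.
Qed.

Lemma ddet_row M N :
  ddet M N = \sum_i \det (\matrix_(k, j) if k == i then N k j else M k j).
Proof.
apply: eq_bigr => i _; rewrite (expand_det_row _ i); apply: eq_bigr => j _.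
rewrite mxE eqxx; congr (_ * (_ * \det _)).
by apply/matrixP => k l; rewrite !mxE [_ == i]eq_sym (negPf (neq_lift _ _)).
Qed.

Lemma ddet_tr M N : ddet M^T N^T = ddet M N.
Proof.
rewrite /ddet exchange_big; apply: eq_bigr => i _; apply: eq_bigr => j _.
by rewrite mxE cofactor_tr.
Qed.

Lemma ddet_row1 i M N : (forall k j, k != i -> N k j = 0) ->
  ddet M N = \det (\matrix_(k, j) if k == i then N k j else M k j).
Proof.
move=> N0; rewrite ddet_row (bigD1 i) //= big1 ?addr0 // => k ki.
rewrite (expand_det_row _ k) big1 // => j _.
by rewrite mxE eqxx N0 ?mul0r.
Qed.

Lemma ddet_col1 i M N : (forall k j, j != i -> N k j = 0) ->
  ddet M N = \det (\matrix_(k, j) if j == i then N k j else M k j).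
Proof.
move=> N0; rewrite -ddet_tr (@ddet_row1 i) => [|k j ki]; last by rewrite mxE N0.
by rewrite -det_tr; congr (\det _); apply/matrixP => k j; rewrite !mxE.
Qed.

End TraceCofactor.

Lemma drv_det (L : fieldType) (D : L -> L) n (M : 'M[L]_n) :
  derivation D -> D (\det M) = ddet M (map_mx D M).
Proof.
move=> dD; rewrite ddet_row (drv_sum dD) exchange_big.
apply: eq_bigr => s _; rewrite (drvM dD) (drv_prod dD) drvX //.
rewrite (drvN dD) (drv1 dD) oppr0 mulr0 mul0r add0r big_distrr.
apply: eq_bigr => i _; congr (_ * _); apply: eq_bigr => j _.
by rewrite !mxE.
Qed.

Section NatMatrices.
Variable L : fieldType.
Implicit Types u : nat -> nat -> L.

Definition natmx n u : 'M[L]_n := \matrix_(i < n, j < n) u i j.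

(** On the indices 0, ..., n this lists 0, ..., n-1, n+1, so composing with it deletes row or column
    n of a matrix of size n+2. *)
Definition skip n i := if i == n then n.+1 else i.

Lemma det_schur n k (A : 'M[L]_n) B C (E : 'M[L]_k) : A \in unitmx ->
  \det (block_mx A B C E) = \det A * \det (E - C *m invmx A *m B).
Proof.
move=> uA; transitivity (\det (block_mx A 0 C 1%:M *m
    block_mx 1%:M (invmx A *m B) 0 (E - C *m invmx A *m B))).
  rewrite mulmx_block !mulmx1 !mulmx0 !mul0mx !addr0 !mul1mx.
  by rewrite mulmxA mulmxV // mul1mx -!mulmxA addrC subrK.
by rewrite det_mulmx det_lblock det_ublock !det1 mulr1 mul1r.
Qed.

Lemma det_mx22 (M : 'M[L]_2) :
  \det M = M ord0 ord0 * M ord_max ord_max - M ord0 ord_max * M ord_max ord0.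
Proof.
rewrite (expand_det_row _ ord0) !big_ord_recl big_ord0 addr0 /cofactor.
rewrite !det_mx11 !mxE expr0 expr1 mul1r mulN1r mulrN.
by congr (M _ _ * M _ _ - M _ _ * M _ _); apply/val_inj.
Qed.

(** Every minor obtained by bordering the leading block A with one row and one column is det A times
    an entry [s] of the Schur complement, and the full determinant is det A times the 2 by 2
    determinant of these entries. *)
Lemma desnanot n u : \det (natmx n u) != 0 ->
  \det (natmx n.+2 u) * \det (natmx n u) =
  \det (natmx n.+1 u) * \det (natmx n.+1 (fun i j => u (skip n i) (skip n j)))
  - \det (natmx n.+1 (fun i j => u (skip n i) j))
    * \det (natmx n.+1 (fun i j => u i (skip n j))).
Proof.
move=> u0; set A := natmx n u; have uA : A \in unitmx by rewrite unitmxE unitfE.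
pose C x := \row_(j < n) u x j : 'rV_n; pose B y := \col_(i < n) u i y.
pose s x y := u x y - (C x *m invmx A *m B y) 0 0.
have d1 (f g : nat -> nat) : (forall i, (i < n)%N -> f i = i) ->
    (forall i, (i < n)%N -> g i = i) ->
    \det (natmx n.+1 (fun i j => u (f i) (g j))) = \det A * s (f n) (g n).
  move=> fK gK; rewrite -addn1.
  have -> : natmx (n + 1) (fun i j => u (f i) (g j))
          = block_mx A (B (g n)) (C (f n)) (u (f n) (g n))%:M.
    apply/matrixP => i j; rewrite mxE.
    case: (split_ordP i) => i' ->; case: (split_ordP j) => j' ->;
      rewrite ?(block_mxEul, block_mxEur, block_mxEdl, block_mxEdr) !mxE /=;
      rewrite ?(ord1 i') ?(ord1 j') /= ?addn0 ?(fK i') ?(gK j') //.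
  by rewrite det_schur // det_mx11 /s [in LHS]mxE [in LHS]mxE [in X in _ + X]mxE eqxx mulr1n.
have d2 : \det (natmx n.+2 u) =
    \det A * (s n n * s n.+1 n.+1 - s n n.+1 * s n.+1 n).
  rewrite -addn2.
  have -> : natmx (n + 2) u = block_mx A (\matrix_(i, j) u i (n + j)%N)
      (\matrix_(i, j) u (n + i)%N j) (\matrix_(i, j) u (n + i)%N (n + j)%N).
    apply/matrixP => i j; rewrite mxE.
    by case: (split_ordP i) => i' ->; case: (split_ordP j) => j' ->;
      rewrite ?(block_mxEul, block_mxEur, block_mxEdl, block_mxEdr) !mxE.
  rewrite det_schur // det_mx22; congr (_ * _).
  have e (i j : 'I_2) : ((\matrix_(i, j) u (n + i)%N (n + j)%N : 'M[L]_2) -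
      (\matrix_(i < 2, j < n) u (n + i)%N j) *m invmx A *m
      (\matrix_(i < n, j < 2) u i (n + j)%N)) i j = s (n + i)%N (n + j)%N.
    rewrite /s !mxE; congr (_ - _); apply: eq_bigr => k _; rewrite !mxE.
    by congr (_ * _); apply: eq_bigr => l _; rewrite !mxE.
  by rewrite !e /= addn0 addn1.
have skK i : (i < n)%N -> skip n i = i by rewrite /skip; case: ltngtP.
rewrite (d1 id id) // (d1 (skip n) (skip n)) // (d1 (skip n) id) //.
rewrite (d1 id (skip n)) // d2 /skip eqxx; ring.
Qed.

End NatMatrices.

Section Wronskian.
Variables (L : fieldType) (D : L -> L).
Hypothesis dD : derivation D.

Definition wronskian n (c : nat -> nat -> L) := \det (natmx n (fun i j => c j i)).

(** Differentiation moves each row to the next one. On all rows but the last this is left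
    multiplication by the nilpotent shift [S], whose trace is 0, so only the last row
    contributes. *)
Lemma drv_wronskian n c : (forall j i, D (c j i) = c j i.+1) ->
  D (wronskian n.+1 c) = \det (natmx n.+1 (fun i j => c j (skip n i))).
Proof.
move=> Dc; rewrite (drv_det _ dD).
pose S : 'M[L]_n.+1 := \matrix_(i, j) (j == i.+1 :> nat)%:R.
pose N : 'M[L]_n.+1 := \matrix_(i, j) (c j i.+1 *+ (i == ord_max)).
have -> : map_mx D (natmx n.+1 (fun i j => c j i))
        = S *m natmx n.+1 (fun i j => c j i) + N.
  apply/matrixP => i j; rewrite !mxE Dc.
  case: (eqVneq i ord_max) => [->|im].
    rewrite mulr1n big1 ?add0r // => k _; rewrite !mxE /=.
    by rewrite [k == _ :> nat]ltn_eqF ?mul0r.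
  have ltin : (i.+1 < n.+1)%N.
    by rewrite ltn_neqAle ltn_ord andbT eqSS; apply: contraNneq im => e; apply/eqP/val_inj.
  rewrite addr0 (bigD1 (Ordinal ltin)) //= !mxE eqxx mul1r big1 ?addr0 // => k ki.
  by rewrite !mxE -(inj_eq val_inj) in ki *; rewrite (negPf ki) mul0r.
rewrite ddetD ddet_mull (@ddet_row1 _ _ ord_max) => [|k j km]; last first.
  by rewrite mxE (negPf km).
rewrite /mxtrace big1 => [|i _]; last by rewrite mxE ltn_eqF.
rewrite mul0r add0r; congr (\det _); apply/matrixP => i j; rewrite !mxE /skip.
by rewrite -(inj_eq val_inj) /=; case: eqP => // ->.
Qed.

Lemma wronskian_jacobi n c : (forall j i, D (c j i) = c j i.+1) ->
  wronskian n c != 0 ->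
  wronskian n.+2 c * wronskian n c =
  wronskian n.+1 c * D (wronskian n.+1 (fun j => c (skip n j)))
  - D (wronskian n.+1 c) * wronskian n.+1 (fun j => c (skip n j)).
Proof. by move=> Dc ?; rewrite !drv_wronskian // -desnanot. Qed.

End Wronskian.

(** * The Toda equation *)

Lemma coef_Xadd1n (R : comNzRingType) r s : (('X + 1%:P : {poly R}) ^+ r)`_s = 'C(r, s)%:R.
Proof.
elim: r s => [|r IH] s; first by rewrite expr0 coef1 bin0n.
rewrite exprSr mulrDr mulr1 coefD coefMX !IH; case: s => [|s] /=.
  by rewrite !bin0 add0r.
by rewrite binS natrD addrC.
Qed.

Section Shift.
Variables (R : comNzRingType) (m : nat) (c : R).

(* ('X + 1)^r (c + (2 'X + 1)^2) with the terms that reach degree m removed: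
   multiplying by q conjugates D into D + 1, so these are the entries of the
   ladder operator in the rows of the Wronskian matrix. *)
Definition shift_poly r : {poly R} :=
  ('X + 1%:P) ^+ r * (4 *: 'X^2 + 4 *: 'X + (1 + c)%:P)
  - 4 *: 'X^(r.+2) - (4 * m%:R) *: 'X^(r.+1).

Lemma coef_shift_poly r s : (shift_poly r)`_s =
  4 * (if (s < 2)%N then 0 else 'C(r, s - 2)%:R)
  + 4 * (if (s < 1)%N then 0 else 'C(r, s - 1)%:R) + (1 + c) * 'C(r, s)%:R
  - 4 * (s == r.+2)%:R - 4 * m%:R * (s == r.+1)%:R.
Proof.
rewrite !coefB !mulrDr !coefD -!scalerAr !coefZ !coefXn coefMXn coefMX coefMC.
rewrite !coef_Xadd1n [_ * (1 + c)]mulrC; congr (_ + _ * _ + _ - _ - _).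
by case: s => //= s; rewrite subn1.
Qed.

(** Only the rows r = m-2 and r = m-1 could reach degree m. Their terms of degree r+2 have
    coefficient 4 and are removed; for r = m-1 the term of degree r+1 has coefficient 4r + 4 = 4m
    and is removed too. Thus no derivative outside the Wronskian matrix is left. *)
Lemma size_shift_poly r : (r < m)%N -> (size (shift_poly r) <= m)%N.
Proof.
move=> rm; apply/leq_sizeP => s ms; rewrite coef_shift_poly.
have [->|] := eqVneq s r.+2.
  rewrite /= !subSS !subn0 binn !bin_small // !mulr0 mulr1 !addr0.
  by rewrite gtn_eqF // mulr0 subrr subr0.
move=> sr; have [e|sr'] := eqVneq s r.+1.
  have em : m = r.+1 by apply/eqP; rewrite eqn_leq -{1}e ms rm.
  rewrite e em subn1 /= binn ['C(r, r.+1)]bin_small // !mulr0 mulr1 !addr0 subr0 mulr1.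
  case: r {rm sr e em} => [|r] /=; first by rewrite mulr0 add0r mulr1 subrr.
  by rewrite !subSS subn0 binSn -!natr1; ring.
by rewrite !bin_small ?if_same ?mulr0 ?addr0 ?subr0 //; lia.
Qed.

Lemma shift_polyP x r : (r < m)%N ->
  (x + 1) ^+ r * (c + (2 * x + 1) ^+ 2) =
  \sum_(s < m) (shift_poly r)`_s * x ^+ s + 4 * x ^+ r.+2 + 4 * m%:R * x ^+ r.+1.
Proof.
move=> rm; rewrite -(horner_coef_wide x (size_shift_poly rm)) /shift_poly.
rewrite !(hornerD, hornerN, hornerM, hornerZ, horner_exp, hornerX, hornerC).
rewrite !exprS; ring.
Qed.

Lemma coef_shift_poly_diag r :
  (shift_poly r)`_r = 4 * 'C(r, 2)%:R + 4 * r%:R + 1 + c.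
Proof.
rewrite coef_shift_poly binn mulr1 !ltn_eqF // !mulr0 !subr0 addrA.
case: r => [|[|r]] //=; rewrite ?subSS ?subn0 ?subn1 /= ?bin1 ?binSn //.
by rewrite -[X in _ = 4 * X%:R + _ + _ + _](@bin_sub r.+2 2) // !subSS subn0.
Qed.

End Shift.

Lemma trace_shift m : \sum_(r < m) ('C(r, 2) * 4 + r * 4 + 1 + 4 * r.+1 ^ 2)%N
  = (m * (2 * m ^ 2 + 2 * m + 1))%N.
Proof.
elim: m => [|m IH]; first by rewrite big_ord0.
rewrite big_ord_recr IH /=; have := bin_ffact m 2.
rewrite ffactnS ffactn1 (_ : 2`! = 2%N) // -!mulnn.
by case: m {IH} => [|m] /=; [rewrite bin0n | nia].
Qed.

Definition hyper (R : comNzRingType) (c : R) k :=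
  \prod_(1 <= l < k.+1) (c + (2 * l%:R - 1) ^+ 2).

Lemma hyperS (R : comNzRingType) (c : R) k :
  hyper c k.+1 = hyper c k * (c + (2 * k%:R + 1) ^+ 2).
Proof. by rewrite /hyper big_nat_recr //= -natr1; congr (_ * (_ + _ ^+ _)); ring. Qed.

Section Toda.
Variables (L : fieldType) (D : L -> L) (q a b : L).
Hypotheses (dD : derivation D) (q0 : q != 0).
Hypotheses (Dq : D q = q) (Da : D a = 0) (Db : D b = 0).

(* the r-th derivative of f_k *)
Definition soliton k r :=
  hyper b k * k%:R ^+ r * q ^+ k - hyper a k * (- k%:R) ^+ r * q^-1 ^+ k.

Let y k := (a + (2 * k%:R - 1) ^+ 2) * (b + (2 * k%:R - 1) ^+ 2).

Lemma drv_hyper c k : D c = 0 -> D (hyper c k) = 0.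
Proof.
move=> Dc; elim: k => [|k IH]; first by rewrite /hyper big_geq // (drv1 dD).
rewrite hyperS (drvM dD) IH mul0r add0r (drvD dD) Dc (drvX dD) (drvD dD).
by rewrite (drvM dD) !(drv_nat dD) (drv1 dD) !(mul0r, mulr0, addr0).
Qed.

Lemma drv_soliton k r : D (soliton k r) = soliton k r.+1.
Proof.
have Dk : D k%:R = 0 by exact: drv_nat.
have DqX n : D (q ^+ n) = n%:R * q ^+ n.
  by rewrite (drvX dD) Dq; case: n => [|n]; rewrite ?mul0r // -mulrA -exprSr.
have DVX n : D (q^-1 ^+ n) = - n%:R * q^-1 ^+ n.
  rewrite (drvX dD) (drvVq dD q0 Dq); case: n => [|n]; rewrite ?oppr0 ?mul0r //=.
  by rewrite mulrN -mulrA -exprSr mulNr.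
rewrite /soliton (drvB dD) !(drvM dD) !drv_hyper //.
rewrite [D (_%:R ^+ r)](drvX dD) [D ((- _) ^+ r)](drvX dD) (drvN dD) Dk.
rewrite DqX DVX oppr0 !(mulr0, mul0r, addr0, add0r) !exprS; ring.
Qed.

Definition tau m := wronskian m (fun j => soliton j.+1).

Definition tau_skip m := wronskian m.+1 (fun j => soliton (skip m j).+1).

Lemma soliton0 r : soliton 0 r = 0.
Proof. by rewrite /soliton /hyper !big_geq // oppr0 !mul1r !expr0 !mulr1 subrr. Qed.

Let C m c : 'M[L]_m := \matrix_(r, s) (shift_poly m c r)`_s.

(* In 4 D^2 f_k = 4 k^2 f_k the second derivative becomes a diagonal column
   operation, which has a computable trace. *)
Lemma soliton_ladder m r k : (r < m)%N ->
  soliton k.+2 r + y k.+1 * soliton k r =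
    q * (\sum_(s < m) (shift_poly m b r)`_s * soliton k.+1 s
         + 4 * k.+1%:R ^+ 2 * soliton k.+1 r + 4 * m%:R * soliton k.+1 r.+1)
  + q^-1 * (\sum_(s < m) ((-1) ^+ (r + s) * (shift_poly m a r)`_s) * soliton k.+1 s
         + 4 * k.+1%:R ^+ 2 * soliton k.+1 r - 4 * m%:R * soliton k.+1 r.+1).
Proof.
move=> rm.
set K := k.+1%:R; set Q := q ^+ k.+1; set P := q^-1 ^+ k.+1.
set A := hyper a k.+1; set B := hyper b k.+1.
have sum c x : \sum_(s < m) (shift_poly m c r)`_s * x ^+ s =
   (x + 1) ^+ r * (c + (2 * x + 1) ^+ 2) - 4 * x ^+ r.+2 - 4 * m%:R * x ^+ r.+1.
  by rewrite (shift_polyP c x rm); ring.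
(* The q^-1 half of the operator is the q half with D replaced by -D, which accounts for the signs
   (-1)^(r+s). *)
have sumN (c x : L) : \sum_(s < m) ((-1) ^+ (r + s) * (shift_poly m c r)`_s) * x ^+ s =
   (x - 1) ^+ r * (c + (2 * x - 1) ^+ 2) - 4 * x ^+ r.+2 + 4 * m%:R * x ^+ r.+1.
  transitivity ((-1) ^+ r * \sum_(s < m) (shift_poly m c r)`_s * (- x) ^+ s).
    rewrite mulr_sumr; apply: eq_bigr => s _.
    by rewrite -[- x]mulN1r exprMn exprD; ring.
  have sg (z : L) : (-1) ^+ r * (- z) ^+ r = z ^+ r by rewrite -exprMn mulN1r opprK.
  rewrite sum !exprS -(sg x) -(sg (x - 1)) opprB [- x + 1]addrC; ring.
have expand (c : nat -> L) : \sum_(s < m) c s * soliton k.+1 s =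
   B * Q * (\sum_(s < m) c s * K ^+ s) - A * P * (\sum_(s < m) c s * (- K) ^+ s).
  rewrite !mulr_sumr -sumrB; apply: eq_bigr => s _.
  rewrite /soliton -/K -/A -/B -/Q -/P; ring.
rewrite (expand (fun s => (shift_poly m b r)`_s)).
rewrite (expand (fun s => (-1) ^+ (r + s) * (shift_poly m a r)`_s)).
rewrite !sum !sumN /y /soliton -/K -/A -/B -/Q -/P !(hyperS _ k.+1) -/A -/B -/K.
have -> : k.+2%:R = K + 1 by rewrite /K natr1.
have kK : k%:R = K - 1 by rewrite /K -natr1 addrK.
have -> : A = hyper a k * (a + (2 * K - 1) ^+ 2).
  by rewrite /A hyperS kK; congr (_ * (_ + _ ^+ _)); ring.
have -> : B = hyper b k * (b + (2 * K - 1) ^+ 2).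
  by rewrite /B hyperS kK; congr (_ * (_ + _ ^+ _)); ring.
rewrite kK /Q /P (_ : - (K - 1) = - K + 1); last by ring.
rewrite (_ : - (K + 1) = - K - 1); last by ring.
rewrite !exprS; field.
exact: q0.
Qed.

(** The ladder relation is read as an identity of matrices and [ddet M] is applied to it. The matrix
    [Y], which shifts the columns, has zero diagonal and drops out; what survives on the left is the
    last column, pushed out of the range. The right side gives traces and D tau. *)
Lemma tau_skipE n : tau_skip n = n.+1%:R * (4 * (q - q^-1) * D (tau n.+1)
   + ((b + (2 * n.+1 ^ 2 + 2 * n.+1 + 1)%:R) * q
      + (a + (2 * n.+1 ^ 2 + 2 * n.+1 + 1)%:R) * q^-1) * tau n.+1).
Proof.
set m := n.+1.
pose M := natmx m (fun i j => soliton j.+1 i).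
pose Y : 'M[L]_m := \matrix_(i, j) ((i == j.+1 :> nat)%:R + y j.+1 * (i.+1 == j)%:R).
pose N : 'M[L]_m := \matrix_(i, j) (soliton j.+2 i *+ (j == ord_max)).
pose K : 'M[L]_m := diag_mx (\row_j (j.+1%:R ^+ 2)).
pose E : 'M[L]_m := \matrix_(i, j) ((-1) ^+ (i + j) * (shift_poly m a i)`_j).
have e : M *m Y + N = q *: (C m b *m M + 4 *: (M *m K) + (4 * m%:R) *: map_mx D M)
   + q^-1 *: (E *m M + 4 *: (M *m K) + (- (4 * m%:R)) *: map_mx D M).
  apply/matrixP => i j; rewrite !mxE.
  have -> : \sum_l (natmx m (fun i j => soliton j.+1 i)) i l * Y l j
          + soliton j.+2 i *+ (j == ord_max) = soliton j.+2 i + y j.+1 * soliton j i.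
    under eq_bigr do rewrite !mxE mulrDr.
    rewrite big_split /= -addrA addrCA addrC; congr (_ + _).
      case: (eqVneq j ord_max) => [->|jm].
        rewrite mulr1n big1 ?add0r // => l _.
        by rewrite [l == _ :> nat]ltn_eqF ?mulr0.
      have ltj : (j.+1 < m)%N.
        by rewrite ltn_neqAle ltn_ord andbT eqSS; apply: contraNneq jm => je; apply/eqP/val_inj.
      rewrite addr0 (bigD1 (Ordinal ltj)) //= eqxx mulr1 big1 ?addr0 // => l lj.
      by rewrite -(inj_eq val_inj) /= in lj; rewrite (negPf lj) mulr0.
    case: j => -[|j] ltj /=.
      by rewrite soliton0 mulr0 big1 // => l _; rewrite !mulr0.
    rewrite (bigD1 (Ordinal (ltnW ltj))) //= eqxx mulr1 [_ * y _]mulrC big1 ?addr0 // => l lj.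
    by rewrite -(inj_eq val_inj) /= in lj; rewrite eqSS (negPf lj) !mulr0.
  rewrite (soliton_ladder _ (ltn_ord i)) !drv_soliton.
  have sE (c : nat -> nat -> L) :
      \sum_(l < m) (\matrix_(i, l) c i l : 'M[L]_m) i l
        * (natmx m (fun i j => soliton j.+1 i)) l j
      = \sum_(l < m) c i l * soliton j.+1 l.
    by apply: eq_bigr => l _; rewrite !mxE.
  rewrite (sE (fun i l => (shift_poly m b i)`_l)).
  rewrite (sE (fun i l => (-1) ^+ (i + l) * (shift_poly m a i)`_l)).
  have -> : \sum_l (natmx m (fun i j => soliton j.+1 i)) i l * K l j
      = soliton j.+1 i * j.+1%:R ^+ 2.
    rewrite (bigD1 j) //= big1 ?addr0 => [|l lj]; first by rewrite !mxE eqxx.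
    by rewrite !mxE (negPf lj) mulr0n mulr0.
  by congr (_ * (_ + _ + _) + _ * (_ + _ + _)); ring.
have := congr1 (ddet M) e.
rewrite !(ddetD, ddetZ, ddet_mull, ddet_mulr) -(drv_det _ dD).
have -> : \det M = tau m by [].
have -> : \tr Y = 0.
  by rewrite /mxtrace big1 // => i _; rewrite mxE ltn_eqF // gtn_eqF // mulr0 addr0.
rewrite mul0r add0r (@ddet_col1 _ _ ord_max) => [|k j km]; last first.
  by rewrite mxE (negPf km).
have -> : \det (\matrix_(k, j) (if j == ord_max then N k j else M k j)) = tau_skip n.
  congr (\det _); apply/matrixP => i j; rewrite !mxE /skip -(inj_eq val_inj) /=.
  by case: eqP => // ->.
move=> ->.
have trC c : \tr (C m c) + 4 * \tr K = m%:R * (c + (2 * m ^ 2 + 2 * m + 1)%:R).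
  rewrite /mxtrace mulr_sumr -big_split /=.
  transitivity (\sum_(i < m) (c + ('C(i, 2) * 4 + i * 4 + 1 + 4 * i.+1 ^ 2)%N%:R)).
    apply: eq_bigr => i _; rewrite !mxE eqxx mulr1n coef_shift_poly_diag.
    by rewrite !natrD !natrM; ring.
  rewrite big_split /= sumr_const card_ord -natr_sum trace_shift natrM.
  by rewrite -[c *+ m]mulr_natl mulrDr.
have trE : \tr E = \tr (C m a).
  by apply: eq_bigr => i _; rewrite !mxE addnn -muln2 exprM sqrr_sign mul1r.
rewrite trE.
have -> : \tr (C m a) = m%:R * (a + (2 * m ^ 2 + 2 * m + 1)%:R) - 4 * \tr K by rewrite -trC addrK.
have -> : \tr (C m b) = m%:R * (b + (2 * m ^ 2 + 2 * m + 1)%:R) - 4 * \tr K by rewrite -trC addrK.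
rewrite -/m; ring.
Qed.

(** This is 16h for U = T (q - q^-1)^(-'C(m+1,2)): the operator 16 t(t-1) d/dt is 4 (q - q^-1) D,
    the power of q - q^-1 contributes the binomial term, and the last two terms are -16 h_0 with a =
    -4 b_1^2 and b = -4 b_2^2. *)
Definition eta_of m (T : L) := 4 * (q - q^-1) * (D T / T)
  - 4 * 'C(m.+1, 2)%:R * (q + q^-1) + a * q^-1 + b * q.

(** By [tau_skipE] the quotient [tau_skip n / tau n.+1] is m (eta + K^2 r), since 4 'C(m+1,2) + 2m^2
    + 2m + 1 = K^2. The Jacobi identity differentiates this quotient, and D r = p. *)
Lemma tau_toda n : q - q^-1 != 0 -> tau n != 0 -> tau n.+1 != 0 ->
  tau n.+2 * tau n = n.+1%:R * (q - q^-1) * tau n.+1 ^+ 2 *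
    (xi D q (eta_of n.+1 (tau n.+1)) + (2 * n.+1 + 1)%:R ^+ 2).
Proof.
move=> p0 tn0 T0; set m := n.+1; set K := (2 * m + 1)%N; set r := q + q^-1.
have eK : (4 * 'C(m.+1, 2) + (2 * m ^ 2 + 2 * m + 1) = K ^ 2)%N.
  have := bin_ffact m.+1 2; rewrite ffactnS ffactn1 (_ : 2`! = 2%N) // -!mulnn.
  by rewrite /K /=; nia.
have {}eK : (2 * m ^ 2 + 2 * m + 1)%:R = K%:R ^+ 2 - 4 * 'C(m.+1, 2)%:R :> L.
  by rewrite -natrX -eK !natrD !natrM; ring.
have eG : tau_skip n = m%:R * (tau m * (eta_of m (tau m) + K%:R ^+ 2 * r)).
  by rewrite tau_skipE -/m eK /eta_of /r; field; rewrite T0 q0.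
have := wronskian_jacobi dD (fun j => drv_soliton j.+1) tn0.
rewrite -/(tau n.+2) -/(tau n.+1) -/(tau n) -/(tau_skip n) -/m => ->.
rewrite eG !(drvM dD) !(drv_nat dD) (drvD dD) (drvM dD) (drvX dD).
rewrite (drv_nat dD) (drv_r dD q0 Dq) /xi; move: (eta_of _ _) => e.
have q2 : q * q - 1 != 0 by rewrite -(mulVf q0) -mulrBl mulf_neq0.
by field; rewrite q0.
Qed.

Hypotheses (p0 : q - q^-1 != 0) (n2 : 2 != 0 :> L).
Hypothesis char0 : forall n, n.+1%:R != 0 :> L.
Hypothesis tau0 : forall n, tau n != 0.

Let p := q - q^-1.
Let r := q + q^-1.
Let e m := eta_of m (tau m).
(** The value 1 in place of tau_{-1} makes the Toda equation hold at m = 0 with constant 1, and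
    makes the chain start from the difference z = 0. *)
Let prev m := if m is m'.+1 then tau m' else 1.

Lemma tau_0 : tau 0 = 1.
Proof. exact: det_mx00. Qed.

Lemma eta_of0 : e 0 = a * q^-1 + b * q.
Proof. by rewrite /e /eta_of tau_0 (drv1 dD) mul0r mulr0 mulr0 mul0r subrr add0r. Qed.

Lemma xi_eta_of0 : xi D q (e 0) = (b * q - a * q^-1) / p.
Proof.
rewrite /xi eta_of0 (drvD dD) !(drvM dD) Da Db (drvVq dD q0 Dq) Dq.
by congr (_ / _); ring.
Qed.

Lemma tau_toda_prev m : exists c, [/\ c != 0, D c = 0 &
  tau m.+1 * prev m = c * p * tau m ^+ 2 * (xi D q (e m) + (2 * m + 1)%:R ^+ 2)].
Proof.
case: m => [|m]; last first.
  exists m.+1%:R; split; [exact: char0 | exact: drv_nat | exact: tau_toda].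
exists 1; split; [exact: oner_neq0 | exact: drv1 | ].
rewrite xi_eta_of0 tau_0 /tau /wronskian det_mx11 mxE /soliton.
rewrite !(hyperS _ 0) /hyper !big_geq // /p /prev !expr0 !expr1; field.
have q2 : q * q - 1 != 0 by rewrite -(mulVf q0) -mulrBl mulf_neq0.
by rewrite q0.
Qed.

Lemma backlund_base : backlund D q a b 1 (e 0) 0.
Proof.
have u0 : upsilon D q (e 0) = mu D q (e 0).
  rewrite /upsilon /mu xi_eta_of0 (drvM dD) (drvB dD) !(drvM dD) Da Db.
  rewrite (drvV dD (q - q^-1)) (drvVq dD q0 Dq) Dq (drv_p dD q0 Dq) eta_of0 /p.
  have q2 : q * q - 1 != 0 by rewrite -(mulVf q0) -mulrBl mulf_neq0.
  by field; rewrite q0.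
have q2 : q * q - 1 != 0 by rewrite -(mulVf q0) -mulrBl mulf_neq0.
split; first by rewrite u0 mulr0 mul1r subrr mulr0.
  by rewrite (drv0 dD) xi_eta_of0 eta_of0 /p; field; rewrite q0.
by rewrite /mu xi_eta_of0 eta_of0 /p; field; rewrite q0.
Qed.

(** The hypothesis of [backlund_step] is the logarithmic derivative of the Toda equation, so from
    its constant c only c != 0 and D c = 0 matter. *)
Lemma backlund_tau m :
  backlund D q a b (2 * m + 1) (e m) (eta_of m.-1 (prev m) - e m).
Proof.
elim: m => [|m IH].
  by rewrite /prev -tau_0 subrr; exact: backlund_base.
have [c [c0 Dc T]] := tau_toda_prev m.
set w := xi D q (e m) + _ in T.
have P0 : prev m != 0 by case: (m) => [|m'] //=; exact: oner_neq0.
have w0 : w != 0.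
  have : tau m.+1 * prev m != 0 by rewrite mulf_neq0.
  by rewrite T mulf_eq0 negb_or => /andP[].
rewrite (_ : (2 * m.+1 + 1 = (2 * m + 1).+2)%N); last by rewrite mulnS.
have -> : e m.+1 = e m + (e m.+1 - e m) by rewrite addrC subrK.
have -> : eta_of m.+1.-1 (prev m.+1) - (e m + (e m.+1 - e m)) = - (e m.+1 - e m).
  by rewrite /= -/(e m) opprD addrA subrr add0r.
apply: (backlund_step dD q0 p0 n2 Dq Da Db IH w0); rewrite -/w.
have {}T : tau m.+1 = c * p * tau m ^+ 2 * w / prev m by rewrite -T mulfK.
have Dw : upsilon D q (e m) = p * D w.
  by rewrite /upsilon /w (drvD dD) (drvX dD) (drv_nat dD) mulr0 addr0.
have DT : D (tau m.+1) = c * (r * tau m ^+ 2 * w + 2 * p * tau m * D (tau m) * w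
     + p * tau m ^+ 2 * D w) / prev m - c * p * tau m ^+ 2 * w * D (prev m) / prev m ^+ 2.
  rewrite T !(drvM dD) Dc (drvV dD) (drv_p dD q0 Dq) -/r.
  by field.
(* The second difference 1 of the binomials yields -4r in the sum of the two differences; it cancels
   4 p (D p / p) = 4r, which comes from the factor p in the Toda equation. *)
have bin : 'C(m.+2, 2)%:R + 'C(m.-1.+1, 2)%:R = 2 * 'C(m.+1, 2)%:R + 1 :> L.
  rewrite -natrD -natrM natr1; congr (_%:R).
  by case: (m) => [|k] //=; rewrite !binS !bin1 !bin0; lia.
have tn := tau0 m.
rewrite Dw /e /eta_of -/p -/r DT T.
have -> : 'C(m.+2, 2)%:R = 2 * 'C(m.+1, 2)%:R + 1 - 'C(m.-1.+1, 2)%:R :> L.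
  by rewrite -bin addrK.
by field; rewrite q0 c0 P0 w0 tn p0.
Qed.

Lemma sigma_tau m :
  upsilon D q (e m) ^+ 2 + xi D q (e m) * mu D q (e m) ^+ 2
    = 4 * (xi D q (e m) - a) * (xi D q (e m) - b) * (xi D q (e m) + (2 * m + 1)%:R ^+ 2).
Proof. exact: backlund_sigma (backlund_tau m). Qed.

End Toda.

(** * Clearing denominators *)

Lemma quotient_ruleD (L : fieldType) (n m k l n' m' k' l' : L) : m != 0 -> l != 0 ->
  ((n' * l + n * l' + (k' * m + k * m')) * (m * l)
    - (n * l + k * m) * (m' * l + m * l')) / (m * l) ^+ 2
  = (n' * m - n * m') / m ^+ 2 + (k' * l - k * l') / l ^+ 2.
Proof. by move=> m0 l0; field; rewrite m0 l0. Qed.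

Lemma quotient_ruleM (L : fieldType) (n m k l n' m' k' l' : L) : m != 0 -> l != 0 ->
  ((n' * k + n * k') * (m * l) - (n * k) * (m' * l + m * l')) / (m * l) ^+ 2
  = (n' * m - n * m') / m ^+ 2 * (k / l) + n / m * ((k' * l - k * l') / l ^+ 2).
Proof. by move=> m0 l0; field; rewrite m0 l0. Qed.

(** * Extension of a derivation to the field of fractions *)

Section FractionDerivation.
Variables (R : idomainType) (d : R -> R).
Hypothesis dd : derivation d.
Local Notation "x %:F" := (tofrac x) : ring_scope.

Lemma fracE (x : {fraction R}) : x = ((frac (repr x)).1)%:F / ((frac (repr x)).2)%:F.
Proof.
have d0 : ((frac (repr x)).2)%:F != 0 by rewrite tofrac_eq0 denom_ratioP.
apply: (mulIf d0); rewrite divfK //; move: {d0} (denom_ratioP (repr x)).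
rewrite -[X in X * _](reprK x); set f := repr x => f0; unlock FracField.tofrac.
rewrite -[LHS]FracField.pi_mul; apply/eqmodP; rewrite /= FracField.equivfE /FracField.mulf.
by rewrite !numden_Ratio ?oner_eq0 ?mulr1 // mulrC.
Qed.

Lemma fracP (x : {fraction R}) : exists n m, m != 0 /\ x = n%:F / m%:F.
Proof.
exists (frac (repr x)).1, (frac (repr x)).2; split; [exact: denom_ratioP | exact: fracE].
Qed.

(** The quotient rule on the numerator and denominator chosen by [repr]; [fderiv_div] shows that any
    other representation gives the same value. *)
Definition fderiv (x : {fraction R}) :=
  (d (frac (repr x)).1 * (frac (repr x)).2 - (frac (repr x)).1 * d (frac (repr x)).2)%:F
  / ((frac (repr x)).2)%:F ^+ 2.

Lemma fderiv_div n m : m != 0 ->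
  fderiv (n%:F / m%:F) = (d n * m - n * d m)%:F / m%:F ^+ 2.
Proof.
move=> m0; have := fracE (n%:F / m%:F); rewrite /fderiv.
have := denom_ratioP (repr (n%:F / m%:F)).
move: ((frac (repr (n%:F / m%:F))).1) ((frac (repr (n%:F / m%:F))).2) => j k k0 /eqP.
rewrite eqr_div ?tofrac_eq0 // -!tofracM tofrac_eq => /eqP e.
have e' : d n * k + n * d k = d j * m + j * d m by rewrite -!(drvM dd) e.
apply/eqP; rewrite -!tofracXn eqr_div ?tofrac_eq0 ?expf_neq0 //.
rewrite -!tofracM tofrac_eq; apply/eqP.
transitivity ((d j * m + j * d m) * k * m - (j * m) * d k * m - j * m * d m * k).
  by ring.
by rewrite -e' -e; ring.
Qed.

Lemma fraction_derivation :
  exists2 D : {fraction R} -> {fraction R}, derivation D & forall n, D n%:F = (d n)%:F.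
Proof.
exists fderiv; move: fderiv fderiv_div => D DE.
  split=> x y; have [n [m [m0 ->]]] := fracP x; have [k [l [l0 ->]]] := fracP y.
    have m1 : m%:F != 0 by rewrite tofrac_eq0.
    have l1 : l%:F != 0 by rewrite tofrac_eq0.
    rewrite addf_div // -!tofracM -tofracD !DE ?mulf_neq0 //.
    rewrite (drvD dd) !(drvM dd) !(tofracB, tofracD, tofracM).
    exact: quotient_ruleD.
  have m1 : m%:F != 0 by rewrite tofrac_eq0.
  have l1 : l%:F != 0 by rewrite tofrac_eq0.
  rewrite mulf_div -!tofracM !DE ?mulf_neq0 //.
  rewrite !(drvM dd) !(tofracB, tofracD, tofracM).
  exact: quotient_ruleM.
move=> n; have d1 : d 1 = 0.
  by apply: (addrI (d 1)); rewrite addr0 -{3}[1]mulr1 (drvM dd) mulr1 mul1r.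
have := DE n 1 (oner_neq0 R).
by rewrite tofrac1 expr1n !divr1 d1 mulr0 subr0 mulr1.
Qed.
End FractionDerivation.

(** With 'X in the role of q = e^theta this is d/dtheta: it fixes 'X and kills constants. *)
Lemma euler_derivation (S : comNzRingType) :
  derivation (fun p : {poly S} => 'X * p^`()).
Proof. by split=> p s; rewrite ?derivD ?derivM; ring. Qed.

(** The determinant is multilinear in its columns, each a sum of two columns of powers; every choice
    of summands leaves a Vandermonde determinant. *)
Lemma det_sum_power (R : comNzRingType) n (c x : bool -> 'I_n -> R) :
  \det (\matrix_(i < n, j < n) \sum_e c e j * x e j ^+ i) =
  \sum_(f : {ffun 'I_n -> bool}) \prod_j c (f j) j
    * \prod_(i < n) \prod_(j < n | (i < j)%N) (x (f j) j - x (f i) i).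
Proof.
rewrite -det_tr; transitivity (\sum_(f : {ffun 'I_n -> bool}) \prod_j c (f j) j
    * \det (Vandermonde n (\row_j x (f j) j))^T); last first.
  apply: eq_bigr => f _; rewrite det_tr det_Vandermonde; congr (_ * _).
  by apply: eq_bigr => i _; apply: eq_bigr => j _; rewrite !mxE.
rewrite /determinant.
under eq_bigr => s _.
  under eq_bigr => i _ do rewrite !mxE.
  rewrite bigA_distr_bigA /= mulr_sumr; over.
rewrite exchange_big; apply: eq_bigr => f _.
rewrite mulr_sumr; apply: eq_bigr => s _.
rewrite big_split mulrCA; congr (_ * (_ * _)).
by apply: eq_bigr => i _; rewrite !mxE.
Qed.

(** The Vandermonde product at the exponents k or -k, k = 1, ..., n, of the exponentials selected by
    [f]. *)
Definition vand n (f : {ffun 'I_n -> bool}) : int :=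
  \prod_(i < n) \prod_(j < n | (i < j)%N)
    ((-1) ^+ (~~ f j) * j.+1%:Z - (-1) ^+ (~~ f i) * i.+1%:Z).

(** This is tau_n multiplied by q^'C(n+1,2): the factor q^k turns a selected q^k into q^(2k) and a
    selected q^-k into 1. *)
Definition tau_poly (S : comNzRingType) n (a b : S) : {poly S} :=
  \sum_(f : {ffun 'I_n -> bool})
    ((vand f)%:~R * \prod_j (if f j then hyper b j.+1 else - hyper a j.+1))
      *: 'X^(\sum_(j | f j) j.+1.*2).

Lemma map_tau_poly (S T : comNzRingType) (h : {rmorphism S -> T}) n a b :
  map_poly h (tau_poly n a b) = tau_poly n (h a) (h b).
Proof.
have hh c k : h (hyper c k) = hyper (h c) k.
  rewrite rmorph_prod; apply: eq_bigr => l _.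
  by rewrite rmorphD rmorphXn rmorphB rmorphM !rmorph_nat rmorph1.
rewrite rmorph_sum; apply: eq_bigr => f _ /=.
rewrite map_polyZ map_polyXn rmorphM rmorph_int; congr ((_ * _) *: _).
by rewrite rmorph_prod; apply: eq_bigr => j _; case: ifP; rewrite ?rmorphN hh.
Qed.

Section Numerators.
Variables (S : comNzRingType) (n : nat) (a b : S) (P : {poly S}).

(* For tau = P / 'X^'C(n+1,2), the denominators of eta, xi, upsilon and mu are
   'X P, xi_den, xi_den^2 and 'X xi_den. *)
Definition eta_num := 4 * 'X * ('X^2 - 1) * P^`() - 8 * 'C(n.+1, 2)%:R * 'X^2 * P
  + (a%:P + b%:P * 'X^2) * P.

Definition xi_den := ('X^2 - 1) * P ^+ 2.

Definition xi_num := eta_num^`() * ('X * P) - eta_num * ('X * P)^`().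

Definition upsilon_num := ('X^2 - 1) * (xi_num^`() * xi_den - xi_num * xi_den^`()).

Definition mu_num := eta_num * ('X^2 - 1) * P - ('X^2 + 1) * xi_num.

(** The identity of [backlund_sigma] with K = 2n + 1, multiplied by 'X^2 times the fourth power of
    [xi_den]. In this form it makes sense even where P vanishes. *)
Definition sigma_poly := 'X^2 * upsilon_num ^+ 2 + xi_num * xi_den * mu_num ^+ 2
  = 4 * 'X^2 * (xi_num - a%:P * xi_den) * (xi_num - b%:P * xi_den)
      * (xi_num + (2 * n + 1)%:R ^+ 2 * xi_den) * xi_den.

End Numerators.

Lemma map_sigma_poly (S T : comNzRingType) (h : {rmorphism S -> T}) n a b P :
  sigma_poly n a b P -> sigma_poly n (h a) (h b) (map_poly h P).
Proof.
have hX2 : map_poly h 'X^2 = 'X^2 := map_polyXn h 2.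
have hX : map_poly h 'X = 'X := map_polyX h.
have hC c : map_poly h c%:P = (h c)%:P := map_polyC h c.
have h1 : map_poly h 1 = 1 := rmorph1 _.
have hn k : map_poly h k%:R = k%:R := rmorph_nat _ k.
have hD p s : map_poly h (p + s) = map_poly h p + map_poly h s := rmorphD _ p s.
have hN p : map_poly h (- p) = - map_poly h p := rmorphN _ p.
have hM p s : map_poly h (p * s) = map_poly h p * map_poly h s := rmorphM _ p s.
have hE p : map_poly h (p ^+ 2) = map_poly h p ^+ 2 := rmorphXn _ 2 p.
pose morphE := (h1, hn, hX, hX2, hC, hE, hM, hN, hD).
have e0 : map_poly h (eta_num n a b P) = eta_num n (h a) (h b) (map_poly h P).
  by rewrite /eta_num !morphE /= deriv_map.
have e1 : map_poly h (xi_den P) = xi_den (map_poly h P).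
  by rewrite /xi_den !morphE.
have e2 : map_poly h (xi_num n a b P) = xi_num n (h a) (h b) (map_poly h P).
  rewrite /xi_num -e0; move: (eta_num n a b P) => H.
  by rewrite !morphE -!deriv_map !morphE.
have e3 : map_poly h (upsilon_num n a b P) = upsilon_num n (h a) (h b) (map_poly h P).
  rewrite /upsilon_num -e1 -e2; move: (xi_num n a b P) (xi_den P) => x d.
  by rewrite !morphE -!deriv_map.
have e4 : map_poly h (mu_num n a b P) = mu_num n (h a) (h b) (map_poly h P).
  rewrite /mu_num -e0 -e2; move: (xi_num n a b P) (eta_num n a b P) => x H.
  by rewrite !morphE.
rewrite /sigma_poly -e1 -e2 -e3 -e4.
move: (xi_num n a b P) (xi_den P) (upsilon_num n a b P) (mu_num n a b P) => x d u m.
by move=> /(congr1 (map_poly h)); rewrite !morphE.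
Qed.

(** * Descent from the differential field to polynomials *)

Section Transport.
Variables (S : idomainType) (a b : S).
Hypothesis char0 : forall n, n.+1%:R != 0 :> S.
Hypothesis a0 : forall k, a + (2 * k%:R + 1) ^+ 2 != 0.

(** Only the choice of q^-k for every k reaches the constant coefficient. Its [vand] is a product of
    nonzero differences of integers, and [a0] keeps the factors [hyper a] away from 0. *)
Lemma tau_poly_neq0 n : tau_poly n a b != 0.
Proof.
suff : (tau_poly n a b).[0] != 0 by apply: contraNneq => ->; rewrite horner0.
rewrite /tau_poly horner_sum (bigD1 [ffun=> false]) //=.
rewrite [X in _ + X]big1 ?addr0 => [|f f0]; last first.
  have [j fj] : exists j, f j.
    apply/existsP; apply: contraNT f0; rewrite negb_exists => /forallP fj.
    by apply/eqP/ffunP => j; rewrite ffunE; apply/negbTE.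
  by rewrite hornerZ hornerXn [X in 0 ^+ X](bigD1 j) //= doubleS addSn exprS mul0r mulr0.
rewrite hornerZ hornerXn [X in 0 ^+ X]big_pred0 => [|j]; last by rewrite ffunE.
rewrite expr0 mulr1 mulf_neq0 //.
  rewrite rmorph_prod; apply/prodf_neq0 => i _.
  rewrite rmorph_prod; apply/prodf_neq0 => j ij.
  rewrite !ffunE /= !expr1 !mulN1r opprK rmorphD rmorphN /= -!pmulrn.
  rewrite addrC -opprB oppr_eq0 -natrB ?ltnS 1?ltnW // subSS.
  by rewrite -[(j - i)%N]prednK ?subn_gt0.
apply/prodf_neq0 => j _; rewrite ffunE oppr_eq0.
elim: (j : nat).+1 => [|k IH]; first by rewrite /hyper big_geq // oner_neq0.
by rewrite hyperS mulf_neq0.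
Qed.

Lemma sum_succ n : (\sum_(j < n) j.+1 = 'C(n.+1, 2))%N.
Proof.
elim: n => [|n IH]; first by rewrite big_ord0.
by rewrite big_ord_recr IH /= [RHS]binS bin1.
Qed.

Section Embedding.
Variables (L : fieldType) (F : {rmorphism {poly S} -> L}).
Let q : L := F 'X.
Hypothesis q_neq0 : q != 0.

Lemma tau_tau_poly n :
  tau q (F a%:P) (F b%:P) n = F (tau_poly n a b) / q ^+ 'C(n.+1, 2).
Proof.
pose c e (j : 'I_n) := if e then hyper (F b%:P) j.+1 * q ^+ j.+1
                 else - (hyper (F a%:P) j.+1 * q^-1 ^+ j.+1).
pose x e (j : 'I_n) : L := if e then j.+1%:R else - j.+1%:R.
have -> : tau q (F a%:P) (F b%:P) n
    = \det (\matrix_(i < n, j < n) \sum_e c e j * x e j ^+ i).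
  congr (\det _); apply/matrixP => i j; rewrite !mxE big_bool /c /x /soliton.
  by rewrite mulNr mulrAC [in X in _ - X]mulrAC.
rewrite det_sum_power rmorph_sum mulr_suml; apply: eq_bigr => f _ /=.
rewrite -mul_polyC !rmorphM /= rmorphXn /= -/q rmorph_int /= rmorph_int.
have -> : \prod_(i < n) \prod_(j < n | (i < j)%N) (x (f j) j - x (f i) i) = (vand f)%:~R.
  rewrite rmorph_prod; apply: eq_bigr => i _; rewrite rmorph_prod; apply: eq_bigr => j _.
  rewrite rmorphB !rmorphM /= !rmorphXn /= rmorphN rmorph1 -!pmulrn.
  by rewrite /x; case: (f i); case: (f j); rewrite ?expr0 ?expr1 ?mul1r ?mulN1r.
rewrite mulrC -!mulrA; congr (_ * _).
have -> : \prod_j c (f j) j =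
    \prod_j F (if f j then hyper b j.+1 else - hyper a j.+1)%:P
    * \prod_j (q ^+ (if f j then j.+1.*2 else 0) / q ^+ j.+1).
  have hh d k : F (hyper d k)%:P = hyper (F d%:P) k.
    rewrite !rmorph_prod; apply: eq_bigr => l _.
    by rewrite !rmorphD !rmorphXn !rmorphB !rmorphM !rmorph_nat !rmorph1.
  rewrite -big_split; apply: eq_bigr => j _; rewrite /c /=; case: ifP => _.
    by rewrite hh -addnn exprD mulfK // expf_neq0.
  by rewrite !rmorphN /= hh expr0 mul1r exprVn mulNr.
rewrite big_split prodrXr prodfV prodrXr sum_succ -big_mkcond; congr (_ * _).
by rewrite !rmorph_prod.
Qed.

Variable D : L -> L.
Hypotheses (dD : derivation D) (DF : forall p, D (F p) = F ('X * p^`())).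
Hypothesis Finj : injective F.

Lemma drv_quotient u v : F v != 0 ->
  D (F u / F v) = q * (F u^`() * F v - F u * F v^`()) / F v ^+ 2.
Proof.
by move=> v0; rewrite (drvM dD) (drvV dD) !DF !rmorphM /= -/q; field.
Qed.

Lemma tau_poly_sigma_embedded n : sigma_poly n a b (tau_poly n a b).
Proof.
have F0 p : p != 0 -> F p != 0 by move=> p0; rewrite -(rmorph0 F) (inj_eq Finj).
have Dq : D q = q by rewrite DF derivX mulr1.
have Dc c : D (F c%:P) = 0 by rewrite DF derivC mulr0 rmorph0.
have Fn k : F k.+1%:R != 0.
  by apply: F0; rewrite -polyC_natr polyC_eq0.
have p0 : 'X^2 - 1 != 0 :> {poly S}.
  by rewrite -size_poly_eq0 size_XnsubC.
have q21 : q ^+ 2 - 1 != 0 by rewrite -rmorphXn -(rmorph1 F) -rmorphB F0.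
have qq0 : q - q^-1 != 0.
  by apply: contraNneq q21 => /(congr1 (fun x => x * q)); rewrite mulrBl mulVf // mul0r => ->.
have charL k : k.+1%:R != 0 :> L by rewrite -(rmorph_nat F).
set P := tau_poly n a b; have P0 : F P != 0 by rewrite F0 ?tau_poly_neq0.
set N := 'C(n.+1, 2).
have tauE k := tau_tau_poly k.
have tau0 k : tau q (F a%:P) (F b%:P) k != 0.
  by rewrite tauE mulf_neq0 ?invr_eq0 ?expf_neq0 // F0 ?tau_poly_neq0.
have := sigma_tau dD q_neq0 Dq (Dc a) (Dc b) qq0 (charL 1%N) charL tau0 n.
set e := eta_of _ _ _ _ _ _.
have E0 : F (xi_den P) != 0 by rewrite F0 // mulf_neq0 ?expf_neq0 ?tau_poly_neq0.
have XP0 : F ('X * P) != 0 by rewrite rmorphM mulf_neq0.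
have Fnat k : F k%:R = k%:R := rmorph_nat F k.
have F1 : F 1 = 1 := rmorph1 F.
have FX : F 'X = q by [].
have FE p k : F (p ^+ k) = F p ^+ k := rmorphXn F k p.
have FD p s : F (p + s) = F p + F s := rmorphD F p s.
have FN p : F (- p) = - F p := rmorphN F p.
have FM p s : F (p * s) = F p * F s := rmorphM F p s.
pose FF := (F1, Fnat, FX, FE, FM, FN, FD).
have q_nz := q_neq0; have q22 : q * q - 1 != 0 by [].
have ee : e = F (eta_num n a b P) / F ('X * P).
  have DQ : D (q ^+ N) = N%:R * q ^+ N.
    by rewrite (drvX dD) Dq; case: (N) => [|k]; rewrite ?mul0r // -mulrA -exprSr.
  have Q0 : q ^+ N != 0 by rewrite expf_neq0.
  rewrite /e /eta_of tauE (drvM dD) (drvV dD) DF DQ -/P -/N /eta_num !FF -/N.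
  move: (q ^+ N) Q0 => Q Q0; move: (F P) P0 (F P^`()) => p p0' p'.
  move: (F a%:P) (F b%:P) (N%:R : L) => A B M; move: (q) q_nz => x x0.
  by field; rewrite p0' x0 Q0.
have ex : xi D q e = F (xi_num n a b P) / F (xi_den P).
  rewrite /xi ee drv_quotient // /xi_num /xi_den.
  move: (eta_num n a b P) => H; move: ('X * P)^`() => Y; rewrite !FF.
  move: (F P) P0 => p p0'; move: (F H) (F H^`()) (F Y) => h h' y.
  move: (q) q_nz q22 => x x0 x2.
  by field; rewrite p0' x0 x2.
have eu : upsilon D q e = F (upsilon_num n a b P) / F (xi_den P) ^+ 2.
  rewrite /upsilon ex drv_quotient // /upsilon_num.
  move: E0; move: (xi_num n a b P) (xi_den P) => x d E0; rewrite !FF.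
  move: (F x) (F x^`()) (F d) (F d^`()) E0 => y y' c c' c0.
  by field; rewrite c0; exact: q_nz.
have em : mu D q e = F (mu_num n a b P) / (q * F (xi_den P)).
  rewrite /mu ex ee /mu_num /xi_den.
  move: (xi_num n a b P) (eta_num n a b P) => x H; rewrite !FF.
  move: (F P) P0 => p p0'; move: (F H) (F x) => h y.
  move: (q) q_nz q22 => z z0 z2.
  by field; rewrite p0' z0 z2.
rewrite /e /= -/e em eu ex /sigma_poly => sg.
apply: Finj; move: sg E0.
move: (xi_num n a b P) (xi_den P) (upsilon_num n a b P) (mu_num n a b P) => x d u m.
rewrite !FF; move: (F a%:P) (F b%:P) (F x) (F d) (F u) (F m) => A B x' d' u' m' sg d0.
move: (q) q_nz sg => z z0 sg.
transitivity (z ^+ 2 * d' ^+ 4 * ((u' / d' ^+ 2) ^+ 2 + x' / d' * (m' / (z * d')) ^+ 2)).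
  by field; rewrite d0 z0.
by rewrite sg; field.
Qed.

End Embedding.

Lemma tau_poly_sigma_generic n : sigma_poly n a b (tau_poly n a b).
Proof.
have [D dD DF] := fraction_derivation (euler_derivation S).
have X0 : tofrac ('X : {poly S}) != 0 by rewrite tofrac_eq0 polyX_eq0.
have T := @tau_poly_sigma_embedded _ (@tofrac {poly S} : {rmorphism {poly S} -> _}).
apply: (T X0 D dD DF).
by move=> p s /eqP; rewrite tofrac_eq => /eqP.
Qed.

End Transport.

(* tau_n vanishes identically for some a and b; it does not over {poly K} with
   a = 'X, and the identity is then specialised. *)
Lemma tau_poly_sigma (K : idomainType) (a b : K) n :
  (forall n, n.+1%:R != 0 :> K) -> sigma_poly n a b (tau_poly n a b).
Proof.
move=> char0.
have charX k : k.+1%:R != 0 :> {poly K} by rewrite -polyC_natr polyC_eq0.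
have aX k : 'X + (2 * k%:R + 1) ^+ 2 != 0 :> {poly K}.
  have -> : (2 * k%:R + 1) ^+ 2 = ((2 * k%:R + 1) ^+ 2)%:P :> {poly K}.
    by rewrite rmorphXn /= rmorphD rmorphM /= !polyC_natr polyC1.
  by rewrite -size_poly_eq0 size_XaddC.
have := map_sigma_poly (horner_eval a) (tau_poly_sigma_generic b%:P charX aX n).
by rewrite map_tau_poly /= /horner_eval !hornerX !hornerC.
Qed.

(** * Reduction of U_{n,m} to Wronskians *)

Section Vandermonde.
Variable F : numFieldType.

(** Each unordered pair on which [f] takes both values can be ordered in exactly one way with the
    false index first. *)
Lemma prod_neq_pairs N (f : {ffun 'I_N -> bool}) (g : 'I_N -> 'I_N -> F) :
  (forall i j, g i j = g j i) ->
  \prod_(i < N) \prod_(j < N | (i < j)%N) (if f i == f j then 1 else g i j)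
  = \prod_(i | ~~ f i) \prod_(j | f j) g i j.
Proof.
move=> gC; pose h i j := if ~~ f i && f j then g i j else 1.
have hh i j : h i j * h j i = if f i == f j then 1 else g i j.
  by rewrite /h [g j i]gC; case: (f i); case: (f j); rewrite /= ?mulr1 ?mul1r.
transitivity (\prod_i \prod_j h i j); last first.
  rewrite [RHS]big_mkcond; apply: eq_bigr => i _; rewrite /h.
  by case: (f i) => /=; [rewrite big1 | rewrite [RHS]big_mkcond].
transitivity ((\prod_(i < N) \prod_(j < N | (i < j)%N) h i j)
    * \prod_(i < N) \prod_(j < N | (j < i)%N) h i j).
  rewrite [X in _ = _ * X](exchange_big_dep predT) //= -big_split; apply: eq_bigr => i _.
  by rewrite -big_split; apply: eq_bigr => j _; rewrite /= hh.
rewrite -big_split; apply: eq_bigr => i _ /=.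
rewrite [RHS](bigID (fun j : 'I_N => (i < j)%N)) /=; congr (_ * _).
have hi : h i i = 1 by rewrite /h andNb.
rewrite [RHS](bigD1 i) ?ltnn //= hi mul1r; apply: eq_bigl => j.
by rewrite -leqNgt ltn_neqAle -(inj_eq val_inj) andbC.
Qed.

(** For i < j the factor is j - i up to sign if the choices agree and i + j + 2 otherwise, and its
    sign is decided by [f j] alone. Extracting all j - i leaves the even-even part of the
    coefficient d(I), where I consists of the false indices. *)
Lemma vandE N (f : {ffun 'I_N -> bool}) :
  (vand f)%:~R = (\prod_(i < N) \prod_(j < N | (i < j)%N) (j - i)%:R)
    * (\prod_(j | ~~ f j) (-1) ^+ j)
    * \prod_(i | ~~ f i) \prod_(j | f j) ((i + j).+2%:R / `|i%:R - j%:R|) :> F.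
Proof.
rewrite -prod_neq_pairs => [|i j]; last by rewrite addnC distrC.
have -> : \prod_(j | ~~ f j) (-1) ^+ j
    = \prod_(i < N) \prod_(j < N | (i < j)%N) (if f j then 1 else -1) :> F.
  rewrite [RHS](exchange_big_dep predT) //= [LHS]big_mkcond; apply: eq_bigr => j _.
  rewrite prodr_const; case: (f j); rewrite ?expr1n //=; congr (_ ^+ _).
  have : (\sum_(i < j) 1 = \sum_(i < N | i < j) 1)%N.
    exact: (big_ord_widen N (fun=> 1%N) (ltnW (ltn_ord j))).
  rewrite sum_nat_const card_ord muln1 => {1}->.
  by rewrite -[RHS]sum1_card; apply: eq_bigl.
rewrite -!big_split rmorph_prod; apply: eq_bigr => i _ /=.
rewrite -!big_split rmorph_prod; apply: eq_bigr => j ij /=.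
rewrite rmorphB !rmorphM /= -!pmulrn.
have ji : `|i%:R - j%:R| = (j - i)%:R :> F by rewrite distrC -natrB ?normr_nat // ltnW.
have ji0 : (j - i)%:R != 0 :> F by rewrite pnatr_eq0 subn_eq0 -ltnNge.
have e : (i + j).+2%:R = j.+1%:R + i.+1%:R :> F by rewrite -natrD; congr (_%:R); lia.
have e' : (j - i)%:R = j.+1%:R - i.+1%:R :> F by rewrite -natrB ?subSS // ltnW.
rewrite ji e !rmorphXn rmorphN rmorph1 /=.
move: e' ji0; move: (j - i)%:R (j.+1%:R : F) (i.+1%:R : F) => d x y -> d0.
by case: (f i); case: (f j); rewrite /= ?expr0 ?expr1; field.
Qed.

Lemma odd_natrB_neq0 k l : (2 * k%:R - 2 * l%:R - 1 != 0 :> F).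
Proof.
rewrite -!natrM -addrA -opprD natr1 subr_eq0 eqr_nat.
by apply/eqP; lia.
Qed.

(** The interaction of the element 2k with 1, 3, ..., 2M-1 in d(I), without the absolute values. *)
Definition odd_prod M k : F :=
  \prod_(l < M) ((2 * k%:R + 2 * l%:R + 1) / (2 * k%:R - 2 * l%:R - 1)).

Lemma odd_prodS M k :
  odd_prod M k.+1 * (2 * k%:R + 1) ^+ 2 = odd_prod M k * ((2 * k%:R + 1) ^+ 2 - 4 * M%:R ^+ 2).
Proof.
elim: M => [|M IH]; first by rewrite /odd_prod !big_ord0; ring.
rewrite /odd_prod !big_ord_recr /= -!/(odd_prod _ _) mulrAC IH.
have := odd_natrB_neq0 k M; have := odd_natrB_neq0 k.+1 M.
rewrite -[k.+1%:R]natr1 -?[M.+1%:R]natr1.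
move: (odd_prod M k) (k%:R : F) (M%:R : F) => x y z h1 h2.
by field; rewrite h1 h2.
Qed.

(** This is where the odd elements replace a = 0 by -4M^2. From k to k+1 the factor (2k+1)^2 of
    [hyper 0] cancels against [odd_prodS], leaving (2k+1)^2 - 4M^2; at k = 0 each of the M factors
    is -1. *)
Lemma hyper_odd_prod M k : hyper 0 k * odd_prod M k = (-1) ^+ M * hyper (- 4 * M%:R ^+ 2) k.
Proof.
elim: k => [|k IH].
  rewrite /hyper !big_geq // mul1r mulr1 /odd_prod -[M in RHS]card_ord -prodr_const.
  apply: eq_bigr => l _; rewrite mulr0 add0r sub0r -opprD divrN divff //.
  by rewrite -natrM natr1 pnatr_eq0.
rewrite !hyperS add0r; transitivity (hyper 0 k * (odd_prod M k.+1 * (2 * k%:R + 1) ^+ 2)).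
  by ring.
by rewrite odd_prodS mulrA IH; ring.
Qed.

(** The negative factors are those with k <= l < M, and truncated subtraction counts them correctly
    also when M <= k. *)
Lemma norm_odd_prod M k :
  \prod_(l < M) `|(2 * k%:R + 2 * l%:R + 1) / (2 * k%:R - 2 * l%:R - 1)|
  = (-1) ^+ (M - k) * odd_prod M k :> F.
Proof.
elim: M => [|M IH]; first by rewrite /odd_prod !big_ord0 expr0 mulr1.
rewrite /odd_prod !big_ord_recr /= -/(odd_prod _ _) IH normf_div.
have -> : `|2 * k%:R + 2 * M%:R + 1| = 2 * k%:R + 2 * M%:R + 1 :> F.
  by rewrite -!natrM -natrD natr1 normr_nat.
case: (ltnP M k) => Mk.
  have -> : `|2 * k%:R - 2 * M%:R - 1| = 2 * k%:R - 2 * M%:R - 1 :> F.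
    by rewrite -!natrM -addrA -opprD natr1 -natrB ?normr_nat //; lia.
  by rewrite (eqP Mk) (eqP (ltnW Mk)) -mulrA.
have -> : `|2 * k%:R - 2 * M%:R - 1| = - (2 * k%:R - 2 * M%:R - 1) :> F.
  have e : - (2 * k%:R - 2 * M%:R - 1) = (2 * M - 2 * k).+1%:R :> F.
    by rewrite -(natr1 (2 * M - 2 * k)%N) natrB ?leq_mul2l // !natrM; ring.
  by rewrite -normrN e normr_nat.
by rewrite subSn // exprS invrN; ring.
Qed.
End Vandermonde.

(** * Even and odd elements of [n;m], and sums over its even subsets *)

Section Bracket.
Local Open Scope fset_scope.
Variables n m : nat.

(* [n;m] = {2, 4, ..., 2N} u {1, 3, ..., 2M-1} *)
Definition n_even := if odd n then n./2 else (n./2 + m)%N.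
Definition n_odd := if odd n then (n./2 + m).+1 else n./2.

Lemma in_bracket x : (x \in bracket n m) =
  ((0 < x <= n) || [&& n < x, x <= n + 2 * m & odd x == odd n])%N.
Proof.
rewrite in_fset /= mem_cat mem_iota add1n ltnS; congr (_ || _).
apply/mapP/idP => [[k]|H]; first by rewrite mem_iota => kb ->; lia.
by exists ((x - n)./2); rewrite ?mem_iota; lia.
Qed.

Lemma even_in_bracket k : (k.+1.*2 \in bracket n m) = (k < n_even)%N.
Proof. by rewrite in_bracket /n_even; case: ifP; lia. Qed.

Lemma odd_in_bracket l : (l.*2.+1 \in bracket n m) = (l < n_odd)%N.
Proof. by rewrite in_bracket /n_odd; case: ifP; lia. Qed.

Lemma zero_notin_bracket : 0%N \notin bracket n m.
Proof. by rewrite in_bracket; lia. Qed.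

Variant bracket_spec : nat -> Prop :=
  | BracketEven (j : 'I_n_even) : bracket_spec j.+1.*2
  | BracketOdd (l : 'I_n_odd) : bracket_spec l.*2.+1.

Lemma bracketP x : x \in bracket n m -> bracket_spec x.
Proof.
case: (boolP (odd x)) => ox.
  rewrite (_ : x = x./2.*2.+1); last by lia.
  by rewrite odd_in_bracket => lx; exact: (BracketOdd (Ordinal lx)).
case: x ox => [|x] ox; first by rewrite (negPf zero_notin_bracket).
rewrite (_ : x.+1 = x./2.+1.*2); last by lia.
by rewrite even_in_bracket => lx; exact: (BracketEven (Ordinal lx)).
Qed.

Implicit Type f : {ffun 'I_n_even -> bool}.

Definition even_seq (f : pred 'I_n_even) :=
  [seq (nat_of_ord j).+1.*2 | j <- enum 'I_n_even & f j].
(** The negation matches [tau_poly], where the false indices carry [hyper a], as a_I goes with I and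
    b with its complement. *)
Definition even_set f : {fset nat} := [fset x in even_seq (fun j => ~~ f j)].

Lemma even_seq_uniq (f : pred 'I_n_even) : uniq (even_seq f).
Proof.
rewrite map_inj_uniq ?filter_uniq -?enumT ?enum_uniq // => i j /eqP.
by rewrite -!muln2 eqn_pmul2r // eqSS => /eqP/val_inj.
Qed.

Lemma mem_even_seq (f : pred 'I_n_even) (j : 'I_n_even) : (j.+1.*2 \in even_seq f) = f j.
Proof.
apply/mapP/idP => [[i]|fj]; last by exists j; rewrite // mem_filter fj mem_enum.
rewrite mem_filter => /andP[fi _] /eqP.
by rewrite -!muln2 eqn_pmul2r // eqSS => /eqP/val_inj ->.
Qed.

Lemma odd_notin_even_seq (f : pred 'I_n_even) l : (l.*2.+1 \in even_seq f) = false.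
Proof. by apply/negbTE/mapP => -[i _]; lia. Qed.

Lemma even_seq_sub (f : pred 'I_n_even) x : x \in even_seq f -> x \in bracket n m.
Proof. by case/mapP => j _ ->; rewrite even_in_bracket. Qed.

Lemma big_even_set (R : Type) (idx : R) (op : Monoid.com_law idx) f (g : nat -> R) :
  \big[op/idx]_(i <- even_set f) g i = \big[op/idx]_(j | ~~ f j) g j.+1.*2.
Proof.
rewrite (perm_big (even_seq (fun j => ~~ f j))) /=.
  by rewrite big_map big_filter big_enum_cond.
apply: uniq_perm; rewrite ?fset_uniq ?even_seq_uniq // => x.
by rewrite inE.
Qed.

Lemma big_even_setC (R : Type) (idx : R) (op : Monoid.com_law idx) f (g : nat -> R) :
  \big[op/idx]_(i <- bracket n m `\` even_set f) g i
  = op (\big[op/idx]_(j | f j) g j.+1.*2) (\big[op/idx]_(l < n_odd) g l.*2.+1).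
Proof.
have -> : \big[op/idx]_(l < n_odd) g l.*2.+1
    = \big[op/idx]_(i <- [seq (nat_of_ord l).*2.+1 | l <- enum 'I_n_odd]) g i.
  by rewrite big_map big_enum.
have -> : \big[op/idx]_(j | f j) g j.+1.*2 = \big[op/idx]_(i <- even_seq f) g i.
  by rewrite big_map big_filter big_enum_cond.
rewrite -big_cat; apply: perm_big; apply: uniq_perm; first exact: fset_uniq.
  rewrite cat_uniq even_seq_uniq /= map_inj_uniq ?enum_uniq => [|i j /eqP]; last first.
    by rewrite eqSS -!muln2 eqn_pmul2r // => /eqP/val_inj.
  rewrite andbT; apply/hasPn => _ /mapP[l _ ->].
  by rewrite /= odd_notin_even_seq.
move=> x; rewrite mem_cat in_fsetD in_fset /=; apply/andP/orP => [[xf xb]|].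
  case: (bracketP xb) xf => [j|l].
    by rewrite mem_even_seq negbK => fj; left; rewrite mem_even_seq.
  by move=> _; right; apply/mapP; exists l; rewrite ?mem_enum.
case => [xf|/mapP[l _ ->]].
  split; last exact: even_seq_sub xf.
  by case/mapP: xf => j; rewrite mem_filter => /andP[fj _] ->; rewrite mem_even_seq fj.
by rewrite odd_notin_even_seq odd_in_bracket.
Qed.

Lemma big_bracket (R : nmodType) (T : {fset nat} -> R) :
  (forall I l, l.*2.+1 \in bracket n m -> l.*2.+1 \in I -> T I = 0) ->
  \sum_(I <- fpowerset (bracket n m)) T I = \sum_(f : {ffun 'I_n_even -> bool}) T (even_set f).
Proof.
move=> T0; pose evens (I : {fset nat}) := all (fun x => ~~ odd x) I.
rewrite (bigID evens) /= addrC big1_seq ?add0r => [|I /andP[Ie]]; last first.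
  rewrite fpowersetE => IB; move: Ie; rewrite /evens -has_predC => /hasP[x xI /=].
  rewrite negbK => ox; apply: (T0 _ x./2).
    by rewrite (_ : x./2.*2.+1 = x) ?(fsubsetP IB) //; lia.
  by rewrite (_ : x./2.*2.+1 = x) //; lia.
rewrite -big_filter -big_enum /= -(big_map even_set xpredT T); apply: perm_big; apply: uniq_perm.
- by rewrite filter_uniq ?fset_uniq.
- rewrite map_inj_uniq ?enum_uniq // => f g fg; apply/ffunP => j.
  have : (j.+1.*2 \in even_set f) = (j.+1.*2 \in even_set g) by rewrite fg.
  by rewrite !in_fset /= !mem_even_seq => /negb_inj.
move=> I; rewrite mem_filter fpowersetE; apply/andP/mapP => [[Ie IB]|[f _ ->]].
  exists [ffun j : 'I_n_even => j.+1.*2 \notin I]; first by rewrite mem_enum.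
  apply/fsetP => x; rewrite in_fset /=; apply/idP/idP => [xI|].
    have := allP Ie _ xI; have := fsubsetP IB _ xI; move: xI => /[swap] /bracketP[j|l] jI.
      by move=> _; rewrite mem_even_seq ffunE negbK.
    by lia.
  by case/mapP => j; rewrite mem_filter ffunE negbK => /andP[jI _] ->.
split; last by apply/fsubsetP => x; rewrite in_fset; exact: even_seq_sub.
by apply/allP => x; rewrite in_fset => /mapP[j _ ->]; lia.
Qed.

End Bracket.

Section Reduction.
Local Open Scope fset_scope.
Variables (F : numFieldType) (n m : nat) (a b : F).
Local Notation N := (n_even n m).
Local Notation M := (n_odd n m).

Lemma pcoef_double c k : pcoef c k.*2 = hyper c k :> F.
Proof.
elim: k => [|k IH]; first by rewrite /pcoef /hyper !big_geq.
rewrite hyperS -IH /pcoef doubleS [LHS]big_mkcond big_nat_recr // big_nat_recr //=.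
rewrite !negbK odd_double /= mulr1 -big_mkcond; congr (_ * (_ + _ ^+ _)).
by rewrite -addn2 natrD -muln2 natrM; ring.
Qed.

Lemma pcoef0_odd l : pcoef 0 l.*2.+1 = 0 :> F.
Proof.
by rewrite /pcoef big_mkcond big_nat_recl //= odd_double /= subrr add0r expr0n mul0r.
Qed.

Lemma sum_odd_square k : (\sum_(l < k) l.*2.+1 = k ^ 2)%N.
Proof. by elim: k => [|k IH]; rewrite ?big_ord0 // big_ord_recr IH /= -!mulnn; lia. Qed.

(** For a = 0 this is [hyper_odd_prod] up to sign: the contribution of 2k to c(I), plus M - k
    truncated, plus M, has the parity of k. If n is even then M = n/2 and the contribution is k - M
    beyond n; if n is odd there is none and k <= M. *)
Lemma even_factor k : a = 0 \/ n = 0%N -> (0 < k <= N)%N ->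
  (-1) ^+ (if (n < k.*2)%N then (k.*2 - n)./2 else 0)
    * (hyper a k * \prod_(l < M) `|(2 * k%:R + 2 * l%:R + 1) / (2 * k%:R - 2 * l%:R - 1)|)
  = (-1) ^+ k * hyper (a - 4 * M%:R ^+ 2) k.
Proof.
move=> an kN; rewrite norm_odd_prod; case: an => [a0|n0]; last first.
  have M0 : M = 0%N by rewrite /n_odd n0.
  rewrite M0 n0 subn0 doubleK /odd_prod big_ord0 mulr1 expr0n mulr0 subr0 mulr1.
  by case: (k) kN.
rewrite a0 sub0r -mulNr [hyper 0 k * _]mulrCA hyper_odd_prod !mulrA; congr (_ * _).
rewrite -!exprD -signr_odd -[RHS]signr_odd; congr (_ ^+ nat_of_bool _).
move: kN; rewrite /n_odd /n_even; case: (boolP (odd n)) => on; case: ifP; lia.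
Qed.

(** Odd elements never lie in a contributing I: a_i contains the factor a for odd i, and there is no
    odd element when n = 0. They only add the common power of w, with exponent 1 + 3 + ... + (2M-1)
    = M^2, and change a. *)
Lemma Upoly_tau : a = 0 \/ n = 0%N -> exists C : F, forall z w q : F,
  q ^+ 2 - 1 != 0 -> z ^+ 2 = (q ^+ 2 - 1)^-1 -> w ^+ 2 = q ^+ 2 / (q ^+ 2 - 1) ->
  Upoly n m z w a b = C * (w ^+ (M ^ 2) / (q ^+ 2 - 1) ^+ 'C(N.+1, 2))
    * (tau_poly N (a - 4 * M%:R ^+ 2) b).[q].
Proof.
move=> an; pose V : F := \prod_(i < N) \prod_(j < N | (i < j)%N) (j - i)%:R.
have V0 : V != 0.
  apply/prodf_neq0 => i _; apply/prodf_neq0 => j ij.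
  by rewrite pnatr_eq0 subn_eq0 -ltnNge.
(* The numerator collects the b_i of the odd elements; [V] is the choice-independent factor that
   [vandE] extracts. *)
exists ((\prod_(l < M) pcoef b l.*2.+1) / V) => z w q q0 hz hw.
rewrite /Upoly big_bracket => [|I l lb lI]; last first.
  suff -> : pcoefs a I = 0 by rewrite mulr0 !mul0r.
  rewrite /pcoefs (big_fsetD1 l.*2.+1) //=; case: an => [->|n0].
    by rewrite pcoef0_odd mul0r.
  by move: lb; rewrite odd_in_bracket /n_odd n0.
rewrite horner_sum mulr_sumr; apply: eq_bigr => f _.
rewrite hornerZ hornerXn vandE -/V.
pose g (i j : 'I_N) : F := (i + j).+2%:R / `|i%:R - j%:R|.
have -> : dcoef F n m (even_set f) = (\prod_(i | ~~ f i) \prod_(j | f j) g i j)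
   * \prod_(i | ~~ f i) \prod_(l < M)
       `|(2 * i.+1%:R + 2 * l%:R + 1) / (2 * i.+1%:R - 2 * l%:R - 1)|.
  rewrite /dcoef big_even_set -big_split; apply: eq_bigr => i _ /=.
  rewrite big_even_setC; congr (_ * _); apply: eq_bigr => j _; rewrite /g.
    have -> : (i.+1.*2%:R + j.+1.*2%:R = 2 * (i + j).+2%:R :> F)%R.
      by rewrite -natrD -natrM; congr (_%:R); lia.
    have -> : (i.+1.*2%:R - j.+1.*2%:R = 2 * (i%:R - j%:R) :> F)%R.
      by rewrite -!mul2n !natrM -mulrBr -!natr1; congr (_ * _); ring.
    by rewrite -mulf_div divff ?pnatr_eq0 // mul1r normf_div normr_nat.
  congr (`|_ / _|)%R.
    by rewrite -!natrM -!natrD natr1; congr (_%:R); lia.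
  by rewrite -[(nat_of_ord j).*2.+1%:R]natr1 -!mul2n !natrM; ring.
have -> : cexp n (even_set f) =
    (\sum_(i | ~~ f i) (if (n < i.+1.*2)%N then (i.+1.*2 - n)./2 else 0))%N.
  by rewrite /cexp big_mkcond big_even_set.
have -> : pcoefs a (even_set f) = \prod_(i | ~~ f i) hyper a i.+1.
  by rewrite /pcoefs big_even_set; apply: eq_bigr => i _; rewrite pcoef_double.
have -> : pcoefs b (bracket n m `\` even_set f)
    = (\prod_(j | f j) hyper b j.+1) * \prod_(l < M) pcoef b l.*2.+1.
  rewrite /pcoefs big_even_setC; congr (_ * _).
  by apply: eq_bigr => i _; rewrite pcoef_double.
have -> : z ^+ weight (even_set f) = \prod_(i | ~~ f i) (q ^+ 2 - 1) ^- i.+1.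
  rewrite /weight big_even_set -prodrXr; apply: eq_bigr => i _.
  by rewrite -mul2n exprM hz exprVn.
have -> : w ^+ weight (bracket n m `\` even_set f) =
    (\prod_(j | f j) (q ^+ 2) ^+ j.+1 * \prod_(j | f j) (q ^+ 2 - 1) ^- j.+1) * w ^+ (M ^ 2).
  rewrite /weight big_even_setC exprD sum_odd_square; congr (_ * _).
  rewrite -prodrXr -big_split; apply: eq_bigr => i _ /=.
  by rewrite -mul2n exprM hw exprMn exprVn.
have -> : q ^+ (\sum_(j | f j) j.+1.*2) = \prod_(j | f j) (q ^+ 2) ^+ j.+1.
  by rewrite -prodrXr; apply: eq_bigr => i _; rewrite -mul2n exprM.
have -> : ((q ^+ 2 - 1) ^+ 'C(N.+1, 2))^-1 =
   (\prod_(j | f j) (q ^+ 2 - 1) ^- j.+1) * \prod_(i | ~~ f i) (q ^+ 2 - 1) ^- i.+1.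
  by rewrite -sum_succ -prodrXr -prodfV (bigID (fun j => f j)).
have -> : \prod_j (if f j then hyper b j.+1 else - hyper (a - 4 * M%:R ^+ 2) j.+1)
   = (\prod_(j | f j) hyper b j.+1) * \prod_(i | ~~ f i) (- hyper (a - 4 * M%:R ^+ 2) i.+1).
  rewrite (bigID (fun j => f j)) /=; congr (_ * _); apply: eq_bigr => i; first by move=> ->.
  by move/negPf => ->.
have key : \prod_(i | ~~ f i) (\prod_(l < M)
       `|(2 * i.+1%:R + 2 * l%:R + 1) / (2 * i.+1%:R - 2 * l%:R - 1)|)
     * (-1) ^+ (\sum_(i | ~~ f i) (if (n < i.+1.*2)%N then (i.+1.*2 - n)./2 else 0))%N
     * \prod_(i | ~~ f i) hyper a i.+1
   = \prod_(i | ~~ f i) (-1) ^+ i * \prod_(i | ~~ f i) (- hyper (a - 4 * M%:R ^+ 2) i.+1).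
  rewrite -prodrXr -!big_split; apply: eq_bigr => i _ /=.
  have := even_factor an (_ : 0 < i.+1 <= N)%N => /(_ (ltn_ord i)).
  rewrite exprS mulN1r mulNr mulrN => <-; ring.
move: key; set P1 := \prod_(i | ~~ f i) \prod_(l < M) _; set S := (-1) ^+ _.
set P2 := \prod_(i | ~~ f i) hyper a _; set P3 := \prod_(i | ~~ f i) (-1) ^+ i.
set P4 := \prod_(i | ~~ f i) (- _) => key.
set B := \prod_(j | f j) hyper _ _; set Z1 := \prod_(i | ~~ f i) (q ^+ 2 - 1) ^- _.
set Z2 := \prod_(i | f i) (q ^+ 2 - 1) ^- _; set Q := \prod_(j | f j) (q ^+ 2) ^+ _.
set G := \prod_(i | ~~ f i) \prod_(j | f j) _; set O := \prod_(l < M) pcoef _ _.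
set W := w ^+ _.
transitivity (G * (P1 * S * P2) * B * O * Z1 * Z2 * Q * W); first by ring.
by rewrite key; field.
Qed.
End Reduction.

From mathcomp Require Import complex.
From mathcomp Require Import all_classical all_reals all_analysis.
From mathcomp Require Import lra.

Import numFieldNormedType.Exports.

Local Open Scope complex_scope.

(** * Derivatives of complex-valued functions *)

Section RealDerivatives.
Variable R : realType.
Implicit Types (f g : R -> R) (t : R).

Lemma is_derive_mul f g t df dg : is_derive t 1 f df -> is_derive t 1 g dg ->
  is_derive t 1 (fun x => f x * g x) (df * g t + f t * dg).
Proof.
move=> hf hg; apply: (is_derive_eq (is_deriveM hf hg)).
by rewrite /GRing.scale /= addrC mulrC.
Qed.

Lemma is_derive_add f g t df dg : is_derive t 1 f df -> is_derive t 1 g dg ->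
  is_derive t 1 (fun x => f x + g x) (df + dg).
Proof. exact: is_deriveD. Qed.

Lemma is_derive_subc f t df (c : R) : is_derive t 1 f df ->
  is_derive t 1 (fun x => f x - c) df.
Proof.
move=> hf; apply: (is_derive_eq (is_derive_add hf (is_derive_cst (- c) t 1))).
by rewrite addr0.
Qed.

Lemma is_derive_opp f t df : is_derive t 1 f df ->
  is_derive t 1 (fun x => - f x) (- df).
Proof. exact: is_deriveN. Qed.

Lemma is_derive_inv f t df : f t != 0 -> is_derive t 1 f df ->
  is_derive t 1 (fun x => (f x)^-1) (- df / f t ^+ 2).
Proof.
move=> f0 hf; apply: (is_derive_eq (is_deriveV f0 hf)).
by rewrite /GRing.scale /= mulrC mulrN mulNr.
Qed.

Lemma is_derive_pow f n t df : is_derive t 1 f df ->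
  is_derive t 1 (fun x => f x ^+ n) (n%:R * f t ^+ n.-1 * df).
Proof.
move=> hf; have -> : (fun x => f x ^+ n) = f ^+ n.
  by apply/funext => x; elim: n => // n IH; rewrite !exprS IH.
exact: is_deriveX.
Qed.

Lemma is_derive_sqrt f t df : 0 < f t -> is_derive t 1 f df ->
  is_derive t 1 (fun x => Num.sqrt (f x)) (df / (2 * Num.sqrt (f t))).
Proof.
move=> f0 hf; apply: (is_derive_eq (is_derive1_comp (is_derive1_sqrt f0) hf)).
by rewrite /GRing.scale /= mulrC.
Qed.

End RealDerivatives.

Section ComplexDerivatives.
Variable R : realType.
Implicit Types (f g : R -> R[i]) (t : R).

Definition is_cderive f t (df : R[i]) :=
  is_derive t 1 (fun x => complex.Re (f x)) (complex.Re df) /\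
  is_derive t 1 (fun x => complex.Im (f x)) (complex.Im df).

Lemma is_cderiveP f t df : is_cderive f t df -> cderivable f t /\ cderive f t = df.
Proof.
case=> -[d1 e1] [d2 e2]; split=> //.
by rewrite /cderive !derive1E e1 e2; case: (df).
Qed.

Lemma is_cderive_eq f t df dg : is_cderive f t df -> df = dg -> is_cderive f t dg.
Proof. by move=> h <-. Qed.

Lemma is_cderive_near f g t df : (\forall x \near t, f x = g x) ->
  is_cderive f t df -> is_cderive g t df.
Proof.
move=> fg [h1 h2]; split.
  by apply: near_eq_is_derive h1; apply: filterS fg => x ->.
by apply: near_eq_is_derive h2; apply: filterS fg => x ->.
Qed.

Lemma is_cderive_cst (c : R[i]) t : is_cderive (fun=> c) t 0.
Proof. by split; exact: is_derive_cst. Qed.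

Lemma is_cderive_real (u : R -> R) t du :
  is_derive t 1 u du -> is_cderive (fun x => (u x)%:C) t du%:C.
Proof. by move=> h; split=> //=; exact: is_derive_cst. Qed.

Lemma is_cderive_add f g t df dg : is_cderive f t df -> is_cderive g t dg ->
  is_cderive (fun x => f x + g x) t (df + dg).
Proof.
move=> [f1 f2] [g1 g2]; split.
  have -> : (fun x => complex.Re (f x + g x)) = (fun x => complex.Re (f x) + complex.Re (g x)).
    by apply/funext => x; case: (f x) (g x) => ? ? [].
  by apply: (is_derive_eq (is_derive_add f1 g1)); case: (df) (dg) => ? ? [].
have -> : (fun x => complex.Im (f x + g x)) = (fun x => complex.Im (f x) + complex.Im (g x)).
  by apply/funext => x; case: (f x) (g x) => ? ? [].
by apply: (is_derive_eq (is_derive_add f2 g2)); case: (df) (dg) => ? ? [].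
Qed.

Lemma is_cderive_mul f g t df dg : is_cderive f t df -> is_cderive g t dg ->
  is_cderive (fun x => f x * g x) t (df * g t + f t * dg).
Proof.
move=> [f1 f2] [g1 g2]; split.
  have -> : (fun x => complex.Re (f x * g x)) =
      (fun x => complex.Re (f x) * complex.Re (g x) + - (complex.Im (f x) * complex.Im (g x))).
    by apply/funext => x; case: (f x) (g x) => ? ? [].
  apply: (is_derive_eq (is_derive_add (is_derive_mul f1 g1) (is_derive_opp (is_derive_mul f2 g2)))).
  by case: (df) (dg) (f t) (g t) => ? ? [? ?] [? ?] [? ?] /=; ring.
have -> : (fun x => complex.Im (f x * g x)) =
    (fun x => complex.Re (f x) * complex.Im (g x) + complex.Im (f x) * complex.Re (g x)).
  by apply/funext => x; case: (f x) (g x) => ? ? [].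
apply: (is_derive_eq (is_derive_add (is_derive_mul f1 g2) (is_derive_mul f2 g1))).
by case: (df) (dg) (f t) (g t) => ? ? [? ?] [? ?] [? ?] /=; ring.
Qed.

Lemma is_cderive_inv f t df : f t != 0 -> is_cderive f t df ->
  is_cderive (fun x => (f x)^-1) t (- df / f t ^+ 2).
Proof.
move=> f0 [f1 f2].
pose n x := complex.Re (f x) * complex.Re (f x) + complex.Im (f x) * complex.Im (f x).
have n0 : n t != 0.
  rewrite /n; apply: contraNneq f0; case: (f t) => u v /= e.
  have [-> ->] : u = 0 /\ v = 0 by split; nra.
  by [].
have norm2 (x y : R) : (x * x - y * y) * (x * x - y * y) + (x * y + y * x) * (x * y + y * x)
    = (x * x + y * y) ^+ 2 by ring.
have dn := is_derive_inv n0 (is_derive_add (is_derive_mul f1 f1) (is_derive_mul f2 f2)).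
split.
  have -> : (fun x => complex.Re (f x)^-1) = (fun x => complex.Re (f x) * (n x)^-1).
    by apply/funext => x; rewrite /n; case: (f x) => u v /=; rewrite !expr2.
  apply: (is_derive_eq (is_derive_mul f1 dn)); move: n0; rewrite /n.
  case: (df) (f t) => u v [x y] /= n0; rewrite ?expr2 /=; field.
  by rewrite n0 andbT norm2 expf_neq0.
have -> : (fun x => complex.Im (f x)^-1) = (fun x => - (complex.Im (f x) * (n x)^-1)).
  by apply/funext => x; rewrite /n; case: (f x) => u v /=; rewrite !expr2.
apply: (is_derive_eq (is_derive_opp (is_derive_mul f2 dn))); move: n0; rewrite /n.
case: (df) (f t) => u v [x y] /= n0; rewrite ?expr2 /=; field.
by rewrite n0 andbT norm2 expf_neq0.
Qed.

Lemma is_cderive_horner (P : {poly R[i]}) (u : R -> R) t du : is_derive t 1 u du ->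
  is_cderive (fun x => P.[(u x)%:C]) t (P^`().[(u t)%:C] * du%:C).
Proof.
move=> hu; elim/poly_ind: P => [|P c IH].
  under eq_fun do rewrite horner0.
  by apply: is_cderive_eq (is_cderive_cst 0 t) _; rewrite deriv0 horner0 mul0r.
under eq_fun do rewrite hornerMXaddC.
apply: is_cderive_eq (is_cderive_add (is_cderive_mul IH (is_cderive_real hu)) (is_cderive_cst c t)) _.
rewrite derivD derivM derivX derivC addr0 mulr1 !(hornerD, hornerM, hornerX) horner0; ring.
Qed.

Lemma is_cderive_neq0 f t df : is_cderive f t df -> f t != 0 -> \forall x \near t, f x != 0.
Proof.
move=> [[f1 _] [f2 _]] f0.
have c1 : {for t, continuous (fun x => complex.Re (f x))}.
  by apply/differentiable_continuous/derivable1_diffP.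
have c2 : {for t, continuous (fun x => complex.Im (f x))}.
  by apply/differentiable_continuous/derivable1_diffP.
have : complex.Re (f t) != 0 \/ complex.Im (f t) != 0.
  case: (f t) f0 => u v uv /=; case: (eqVneq u 0) => u0; [right | by left].
  by apply: contraNneq uv => ->; rewrite u0.
case=> h.
  have : \forall x \near t, complex.Re (f x) != 0 by exact: cvgr_neq0 c1 h.
  by apply: filterS => x; apply: contraNneq => ->.
have : \forall x \near t, complex.Im (f x) != 0 by exact: cvgr_neq0 c2 h.
by apply: filterS => x; apply: contraNneq => ->.
Qed.

End ComplexDerivatives.

(** * The solutions *)

Section Uniformization.
Variable R : realType.
Implicit Types t : R.

Definition qfun t := (Num.sqrt t + Num.sqrt (t - 1)) ^+ 2.

Lemma sqrt_facts t : 1 < t -> exists s u : R, [/\ Num.sqrt t = s, Num.sqrt (t - 1) = u,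
  0 < s, 0 < u & t = s ^+ 2 /\ s ^+ 2 - u ^+ 2 = 1].
Proof.
move=> t1; exists (Num.sqrt t), (Num.sqrt (t - 1)).
by split; rewrite ?sqrtr_gt0 ?sqr_sqrtr; (try split); lra.
Qed.

Lemma qfun_gt0 t : 1 < t -> 0 < qfun t.
Proof. by case/sqrt_facts => s [u [es eu s0 u0 _]]; rewrite /qfun es eu exprn_gt0 ?addr_gt0. Qed.

Lemma qfun_sqr t : 1 < t ->
  qfun t ^+ 2 - 1 = 4 * Num.sqrt t * Num.sqrt (t - 1) * qfun t.
Proof.
case/sqrt_facts => s [u [es eu _ _ [_ e]]]; rewrite /qfun es eu.
by rewrite -[1](expr1n _ 2) -{1}e; ring.
Qed.

Lemma qfun_sqr_gt0 t : 1 < t -> 0 < qfun t ^+ 2 - 1.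
Proof.
move=> t1; have [s [u [es eu s0 u0 _]]] := sqrt_facts t1; rewrite qfun_sqr // es eu.
by rewrite (mulr_gt0 (mulr_gt0 (mulr_gt0 _ s0) u0) (qfun_gt0 t1)).
Qed.

Lemma qfunV t : 1 < t -> (qfun t)^-1 = (Num.sqrt t - Num.sqrt (t - 1)) ^+ 2.
Proof.
move=> t1; have q0 := lt0r_neq0 (qfun_gt0 t1); apply: (mulfI q0); rewrite mulfV //.
move: t1; case/sqrt_facts => s [u [es eu _ _ [_ e]]]; rewrite /qfun es eu.
by rewrite -[1](expr1n _ 2) -{1}e; ring.
Qed.

Lemma mul_t_pred t : 1 < t -> t * (t - 1) = (qfun t ^+ 2 - 1) ^+ 2 / (16 * qfun t ^+ 2).
Proof.
move=> t1; have q0 := lt0r_neq0 (qfun_gt0 t1); rewrite qfun_sqr //.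
have [s [u [es eu _ _ [et e]]]] := sqrt_facts t1; move: q0; rewrite es eu => q0.
have -> : t * (t - 1) = s ^+ 2 * u ^+ 2 by rewrite et -[X in _ - X]e; ring.
by field.
Qed.

Lemma double_t t : 1 < t -> 2 * t - 1 = (qfun t + (qfun t)^-1) / 2.
Proof.
move=> t1; rewrite qfunV // /qfun; have [s [u [-> -> _ _ [-> e]]]] := sqrt_facts t1.
by rewrite -[X in _ - X]e; field.
Qed.

Lemma h0funE (b1 b2 : R[i]) t : 1 < t ->
  h0fun b1 b2 t = 4^-1 * (b1 ^+ 2 / (qfun t)%:C + b2 ^+ 2 * (qfun t)%:C).
Proof. by move=> t1; rewrite /h0fun -qfunV // fmorphV. Qed.

Lemma vfunE t : 1 < t -> exists2 d : R, 0 < d &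
  [/\ vfun t - 2 = (Num.sqrt t - Num.sqrt (t - 1)) ^+ 2 / d,
      vfun t + 2 = qfun t / d & qfun t ^+ 2 - 1 = 4 * d * qfun t].
Proof.
move=> t1; exists (Num.sqrt t * Num.sqrt (t - 1)).
  by rewrite mulr_gt0 // sqrtr_gt0; lra.
have sq (x y : R) : 0 <= x -> 0 <= y -> Num.sqrt (x / y) = Num.sqrt x / Num.sqrt y.
  by move=> x0 y0; rewrite sqrtrM // sqrtrV.
rewrite qfun_sqr // mulrA /vfun !sq; try lra.
rewrite /qfun; have [s [u [-> -> s0 u0 _]]] := sqrt_facts t1.
by split=> //; field; rewrite ?lt0r_neq0.
Qed.

Lemma zfun_sqr t : 1 < t -> zfun t ^+ 2 = (qfun t ^+ 2 - 1)^-1.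
Proof.
move=> t1; have [d d0 [e1 _ e3]] := vfunE t1; have q0 := qfun_gt0 t1.
rewrite /zfun exprMn sqr_sqrtr; last by rewrite e1 divr_ge0 ?sqr_ge0 // ltW.
by rewrite e1 e3 -qfunV //; field; rewrite !lt0r_neq0.
Qed.

Lemma wfun_sqr t : 1 < t -> wfun t ^+ 2 = qfun t ^+ 2 / (qfun t ^+ 2 - 1).
Proof.
move=> t1; have [d d0 [_ e2 e3]] := vfunE t1; have q0 := qfun_gt0 t1.
rewrite /wfun exprMn sqr_sqrtr; last by rewrite e2 divr_ge0 // ltW.
by rewrite e2 e3; field; rewrite !lt0r_neq0.
Qed.

Lemma wfun_gt0 t : 1 < t -> 0 < wfun t.
Proof.
move=> t1; have [d d0 [_ e2 _]] := vfunE t1; have q0 := qfun_gt0 t1.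
by rewrite /wfun mulr_gt0 ?invr_gt0 // sqrtr_gt0 e2 divr_gt0.
Qed.

(** Equivalent to d/dt = 4/(q - q^-1) D with D q = q, which carries the differential algebra over to
    functions of t. *)
Lemma is_derive_qfun t : 1 < t ->
  is_derive t 1 qfun (4 * qfun t ^+ 2 / (qfun t ^+ 2 - 1)).
Proof.
move=> t1.
have d1 : is_derive t 1 (fun x : R => x) (1 : R) by exact: is_derive_id.
have d2 : is_derive t 1 (fun x : R => x - 1) (1 : R).
  exact: is_derive_subc.
have t0 : 0 < t by lra. have t10 : 0 < t - 1 by lra.
have := is_derive_pow 2 (is_derive_add (@is_derive_sqrt R (fun x => x) t 1 t0 d1)
  (@is_derive_sqrt R (fun x => x - 1) t 1 t10 d2)).
rewrite qfun_sqr // => h; apply: (is_derive_eq h); rewrite /qfun.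
have [s [u [-> -> s0 u0 _]]] := sqrt_facts t1.
by field; rewrite !lt0r_neq0 ?addr_gt0.
Qed.

Lemma is_derive_wfun t : 1 < t ->
  is_derive t 1 (@wfun R) (- 4 * qfun t / (qfun t ^+ 2 - 1) ^+ 2 * wfun t).
Proof.
move=> t1; have q0 := qfun_gt0 t1; have q1 := qfun_sqr_gt0 t1.
pose W x := qfun x * qfun x * (qfun x * qfun x - 1)^-1.
have WE x : 1 < x -> wfun x = Num.sqrt (W x).
  by move=> x1; rewrite /W -expr2 -wfun_sqr // sqrtr_sqr gtr0_norm ?wfun_gt0.
apply: (@near_eq_is_derive _ _ _ (fun x => Num.sqrt (W x))).
  have := lt_nbhsr t1; apply: filterS => x x1; exact/esym/WE.
have dq := is_derive_qfun t1; have dqq := is_derive_mul dq dq.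
have c0 : qfun t * qfun t - 1 != 0 by rewrite -expr2 lt0r_neq0.
have W0 : 0 < W t by rewrite /W -expr2; apply: divr_gt0 => //; apply: exprn_gt0.
have h := @is_derive_sqrt R W t _ W0 (is_derive_mul dqq
  (@is_derive_inv R (fun x => qfun x * qfun x - 1) t _ c0 (is_derive_subc 1 dqq))).
apply: (is_derive_eq h); rewrite -WE //.
have w0 := wfun_gt0 t1; have w2 := wfun_sqr t1.
have e k : k * wfun t = k * (qfun t ^+ 2 / (qfun t ^+ 2 - 1)) / wfun t.
  by rewrite -w2; field; rewrite lt0r_neq0.
rewrite [RHS]e !expr2 /W; move: w0 q0 c0; move: (wfun t) (qfun t) => w q w0 q0 c0.
by field; rewrite c0 !lt0r_neq0.
Qed.

(** The elementary factor in [Upoly_tau], used with K = M^2 and c = 'C(N+1,2). *)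
Definition gfun K c t := wfun t ^+ K * (qfun t ^+ 2 - 1) ^- c.

Lemma gfun_neq0 K c t : 1 < t -> gfun K c t != 0.
Proof.
move=> t1; have := wfun_gt0 t1; have := qfun_sqr_gt0 t1 => q1 w0.
by rewrite mulf_neq0 ?invr_eq0 ?expf_neq0 ?lt0r_neq0.
Qed.

Lemma is_derive_gfun K c t : 1 < t ->
  is_derive t 1 (gfun K c) (gfun K c t * (- 4 * K%:R * qfun t / (qfun t ^+ 2 - 1) ^+ 2
     - 8 * c%:R * qfun t ^+ 3 / (qfun t ^+ 2 - 1) ^+ 2)).
Proof.
move=> t1; have w0 := lt0r_neq0 (wfun_gt0 t1).
have q1 := lt0r_neq0 (qfun_sqr_gt0 t1); have q0 := lt0r_neq0 (qfun_gt0 t1).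
have dq := is_derive_pow 2 (is_derive_qfun t1).
have dq1 := is_derive_pow c (is_derive_subc 1 dq).
have qc0 : (qfun t ^+ 2 - 1) ^+ c != 0 by rewrite expf_neq0.
have h := is_derive_mul (is_derive_pow K (is_derive_wfun t1)) 
  (@is_derive_inv R (fun x => (qfun x ^+ 2 - 1) ^+ c) t _ qc0 dq1).
apply: (is_derive_eq h); rewrite /gfun.
have pK (x : R) n : x != 0 -> n%:R * x ^+ n.-1 = n%:R * x ^+ n / x.
  by move=> x0; case: n => [|n]; rewrite ?mul0r // exprSr mulrA mulfK.
rewrite (pK _ K) // (pK _ c) // expr1; move: qc0 q1 w0 q0.
move: (wfun t ^+ K) ((qfun t ^+ 2 - 1) ^+ c) => A B B0.
by move: (wfun t) (qfun t) => w q q1 w0 q0; field; rewrite ?q1 ?w0 ?B0.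
Qed.

End Uniformization.

Section RealComplex.
Variable R : realType.
Local Notation C := (real_complex R).

Lemma realcM x y : C (x * y) = C x * C y. Proof. exact: rmorphM. Qed.
Lemma realcB x y : C (x - y) = C x - C y. Proof. exact: rmorphB. Qed.
Lemma realcV x : C x^-1 = (C x)^-1. Proof. exact: fmorphV. Qed.
Lemma realcX x k : C (x ^+ k) = C x ^+ k. Proof. exact: rmorphXn. Qed.
Lemma realc_nat k : C k%:R = k%:R. Proof. exact: rmorph_nat. Qed.
Lemma realcD x y : C (x + y) = C x + C y. Proof. exact: rmorphD. Qed.
Lemma realcN x : C (- x) = - C x. Proof. exact: rmorphN. Qed.
Lemma realc1 : C 1 = 1. Proof. by []. Qed.

Lemma real_complex_neq0 x : x != 0 -> C x != 0.
Proof. by move=> x0; rewrite -(rmorph0 C) (inj_eq (fmorph_inj _)). Qed.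

End RealComplex.

Lemma horner_nat (S : comNzRingType) k (x : S) : k%:R.[x] = k%:R.
Proof. by rewrite -polyC_natr hornerC. Qed.

Section Solutions.
Variables (R : realType) (n m : nat) (b1 b2 : R[i]).
Hypothesis hb : b1 = 0 \/ n = 0%N.

Let N := n_even n m.
Let M := n_odd n m.
Let A : R[i] := - 4 * b1 ^+ 2 - 4 * M%:R ^+ 2.
Let B : R[i] := - 4 * b2 ^+ 2.
Let P := tau_poly N A B.
Let q (t : R) : R[i] := (qfun t)%:C.

Lemma q_neq0 t : 1 < t -> q t != 0.
Proof. by move=> t1; rewrite real_complex_neq0 // lt0r_neq0 // qfun_gt0. Qed.

Lemma q_sqr_neq0 t : 1 < t -> q t ^+ 2 - 1 != 0.
Proof.
move=> t1; have := real_complex_neq0 (lt0r_neq0 (qfun_sqr_gt0 t1)).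
by rewrite realcB (realcX (qfun t)).
Qed.

Lemma UfunE : exists C : R[i], forall t, 1 < t ->
  Ufun n m b1 b2 t = C * (gfun (M ^ 2) 'C(N.+1, 2) t)%:C * P.[q t].
Proof.
have an : - 4 * b1 ^+ 2 = 0 \/ n = 0%N.
  by case: hb => [->|]; [left; rewrite expr0n mulr0 | right].
have [C UE] := @Upoly_tau R[i] n m _ B an.
exists C => t t1; rewrite /Ufun (UE _ _ (q t)) ?q_sqr_neq0 //.
- rewrite /gfun (realcM (wfun t ^+ _)) realcV (realcX (wfun t)).
  by rewrite (realcX (qfun t ^+ 2 - 1)) realcB (realcX (qfun t)).
- by rewrite -realcX zfun_sqr // realcV realcB (realcX (qfun t)).
- by rewrite -realcX wfun_sqr // realcM realcV realcB (realcX (qfun t)).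
Qed.

(** The constant C of [UfunE] is 0 for some parameters, but then U vanishes identically and the
    domain is empty. Openness of the domain allows identities on it to be differentiated. *)
Lemma hdomP t : hdom n m b1 b2 t ->
  [/\ 1 < t, P.[q t] != 0 & \forall x \near t, hdom n m b1 b2 x].
Proof.
have [C UE] := UfunE => -[t1]; rewrite UE // !mulf_eq0 !negb_or => /andP[/andP[C0 _] P0].
split=> //; have := is_cderive_neq0 (is_cderive_horner P (is_derive_qfun t1)) P0.
have := lt_nbhsr t1; apply: filterS2 => x x1 Px; split=> //.
by rewrite UE // !mulf_neq0 // real_complex_neq0 // gfun_neq0.
Qed.

(** The logarithmic derivative of w^(M^2), times t(t-1), is -M^2/(4q); it joins the term -b_1^2/(4q)
    of -h_0, which explains the shift by -4M^2 in [A]. *)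
Lemma hfunE t : hdom n m b1 b2 t ->
  hfun n m b1 b2 t = (eta_num N A B P).[q t] / (16 * 'X * P).[q t].
Proof.
move=> ht; have [t1 P0 _] := hdomP ht; have [C UE] := UfunE.
have [_] := ht; rewrite UE // !mulf_eq0 !negb_or => /andP[/andP[C0 g0] _].
have dU := is_cderive_mul (is_cderive_mul (is_cderive_cst C t)
   (is_cderive_real (is_derive_gfun (M ^ 2) 'C(N.+1, 2) t1)))
   (is_cderive_horner P (is_derive_qfun t1)).
have nU : \forall x \near t,
    C * (gfun (M ^ 2) 'C(N.+1, 2) x)%:C * P.[q x] = Ufun n m b1 b2 x.
  by have := lt_nbhsr t1; apply: filterS => x x1; rewrite UE.
have [_ dUE] := is_cderiveP (is_cderive_near nU dU).
rewrite /hfun dUE UE // h0funE // mul_t_pred // /eta_num.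
have x0 := q_neq0 t1; have x1 := q_sqr_neq0 t1.
move: g0 P0 x0 x1; rewrite -/(q t) !(hornerD, hornerN, hornerM, hornerC) !horner_nat.
rewrite !hornerX /q.
move: (gfun _ _ t) (P.[(qfun t)%:C]) (P^`().[(qfun t)%:C]) (qfun t) => g p p' x.
rewrite natrX !(realcM, realcB, realcV, realcX, realc_nat, realcN) realc1 /A /B.
move: x%:C g%:C => {}x {}g g0 p0 x0 x1.
have x1' : x * x - 1 != 0 by [].
by field; rewrite ?C0 ?g0 ?p0 ?x0 ?x1'.
Qed.

Lemma is_cderive_ratio (X Y : {poly R[i]}) t : 1 < t -> Y.[q t] != 0 ->
  is_cderive (fun x => X.[q x] / Y.[q x]) t
    ((X^`().[q t] * Y.[q t] - X.[q t] * Y^`().[q t]) / Y.[q t] ^+ 2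
      * (4 * q t ^+ 2 / (q t ^+ 2 - 1))).
Proof.
move=> t1 Y0; have dq := is_derive_qfun t1.
apply: is_cderive_eq (is_cderive_mul (is_cderive_horner X dq)
  (is_cderive_inv Y0 (is_cderive_horner Y dq))) _.
rewrite -/(q t).
have -> : (4 * qfun t ^+ 2 / (qfun t ^+ 2 - 1))%:C = 4 * q t ^+ 2 / (q t ^+ 2 - 1).
  by rewrite realcM realcV realcM realcB (realcX (qfun t)) realc_nat.
by move: (_ / (q t ^+ 2 - 1)) => d; field.
Qed.

Lemma deriv_natl k (p : {poly R[i]}) : (k%:R * p)^`() = k%:R * p^`().
Proof. by rewrite !mulr_natl derivMn. Qed.

Lemma xi_den_neq0 t : hdom n m b1 b2 t -> (xi_den P).[q t] != 0.
Proof.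
case/hdomP => t1 P0 _; rewrite /xi_den expr2 !(hornerD, hornerN, hornerM, hornerC) !hornerX.
by rewrite mulf_neq0 ?mulf_neq0 //; exact: q_sqr_neq0.
Qed.

Lemma is_cderive_hfun t : hdom n m b1 b2 t ->
  is_cderive (hfun n m b1 b2) t ((xi_num N A B P).[q t] / (4 * xi_den P).[q t]).
Proof.
move=> ht; have [t1 P0 nH] := hdomP ht; have E0 := xi_den_neq0 ht.
have x0 := q_neq0 t1; have x1 := q_sqr_neq0 t1.
have Y0 : (16 * 'X * P).[q t] != 0.
  by rewrite -mulrA hornerM horner_nat hornerM hornerX !mulf_neq0 ?pnatr_eq0.
have nh : \forall x \near t, (eta_num N A B P).[q x] / (16 * 'X * P).[q x] = hfun n m b1 b2 x.
  by apply: filterS nH => x hx; rewrite hfunE.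
apply: is_cderive_eq (is_cderive_near nh (is_cderive_ratio _ t1 Y0)) _.
rewrite -[16 * 'X * P]mulrA deriv_natl /xi_num /xi_den expr2.
move: ('X * P)^`() (eta_num N A B P) => Z H.
rewrite ![(_ * _).[_]]hornerM !horner_nat.
rewrite !(hornerD, hornerN, hornerM, hornerC) !hornerX.
move: (H^`().[q t]) (H.[q t]) (Z.[q t]) (P.[q t]) P0 => h' h z p p0.
move: (q t) x0 x1 => x x0 x1.
have x1' : x * x - 1 != 0 by [].
by field; rewrite ?x0 ?p0 ?x1'.
Qed.

(** E_VI with one parameter 0 and the factor h' removed. Under [hb] either b_1 = 0 or M = 0, so
    b_1^2 + M^2 is the square of a single parameter. *)
Theorem hfun_sigma t (ht : hdom n m b1 b2 t) (h := hfun n m b1 b2)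
    (h' := cderive h t) (h'' := cderive (cderive h) t) :
  [/\ cderivable h t, cderivable (cderive h) t &
   ((t * (t - 1))%:C * h'') ^+ 2 + h' * (2 * h t - (2 * t - 1)%:C * h') ^+ 2
   = (h' + b1 ^+ 2 + M%:R ^+ 2) * (h' + b2 ^+ 2) * (h' + (N%:R + 1 / 2) ^+ 2)].
Proof.
have [t1 P0 nH] := hdomP ht; have E0 := xi_den_neq0 ht.
have x0 := q_neq0 t1; have x1 := q_sqr_neq0 t1.
have [hd hE] := is_cderiveP (is_cderive_hfun ht).
have n2 : \forall x \near t, (xi_num N A B P).[q x] / (4 * xi_den P).[q x] = cderive h x.
  by apply: filterS nH => x hx; have [_ ->] := is_cderiveP (is_cderive_hfun hx).
have Y0 : (4 * xi_den P).[q t] != 0 by rewrite hornerM horner_nat mulf_neq0 ?pnatr_eq0.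
have [hd2 hE2] := is_cderiveP (is_cderive_near n2 (is_cderive_ratio _ t1 Y0)).
have eT : (t * (t - 1))%:C = (q t ^+ 2 - 1) ^+ 2 / (16 * q t ^+ 2).
  rewrite mul_t_pred // /q; move: (qfun t) => x.
  by rewrite !(realcM, realcB, realcV, realcX, realc_nat).
have eT2 : (2 * t - 1)%:C = (q t + (q t)^-1) / 2.
  rewrite double_t // /q; move: (qfun t) => x.
  by rewrite !(realcM, realcD, realcV, realc_nat).
split=> //; rewrite /h'' /h' hE2 /h hE hfunE // eT eT2.
have charC k : k.+1%:R != 0 :> R[i] by rewrite pnatr_eq0.
have := congr1 (fun p => p.[q t]) (tau_poly_sigma A B N charC).
have : (xi_den P).[q t] = (q t ^+ 2 - 1) * P.[q t] ^+ 2.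
  by rewrite /xi_den !(hornerD, hornerN, hornerM, hornerC) !hornerX expr2.
have : (mu_num N A B P).[q t] = (eta_num N A B P).[q t] * (q t ^+ 2 - 1) * P.[q t]
    - (q t ^+ 2 + 1) * (xi_num N A B P).[q t].
  rewrite /mu_num; move: (eta_num _ _ _ _) (xi_num _ _ _ _) => H X.
  by rewrite !(hornerD, hornerN, hornerM, hornerC) !hornerX.
have : (upsilon_num N A B P).[q t] = (q t ^+ 2 - 1)
   * ((xi_num N A B P)^`().[q t] * (xi_den P).[q t]
   - (xi_num N A B P).[q t] * (xi_den P)^`().[q t]).
  rewrite /upsilon_num; move: (xi_den _) (xi_num _ _ _ _) => D X.
  by rewrite !(hornerD, hornerN, hornerM, hornerC) !hornerX.
rewrite /sigma_poly -/P deriv_natl.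
move: E0 P0 x0 x1.
rewrite ![(4 * xi_den _).[_]]hornerM [(4 * _^`()).[_]]hornerM.
rewrite [(16 * 'X * _).[_]]hornerM [(16 * 'X).[_]]hornerM hornerX.
move: (xi_num N A B P) (xi_den P) (upsilon_num N A B P) (mu_num N A B P) (eta_num N A B P).
move=> X D U V H; rewrite !(horner_nat, hornerD, hornerN, hornerM, hornerC) !hornerX.
move: (X.[q t]) (X^`().[q t]) (D.[q t]) (D^`().[q t]) (U.[q t]) (V.[q t]) (H.[q t]) (P.[q t]).
move: (q t) => x {X D U V H} X X' D D' U V H p D0 p0 x0 x1 eU eV eD sg.
have x1' : x * x - 1 != 0 by [].
have -> : 2 * (H / (16 * x * p)) - (x + x^-1) / 2 * (X / (4 * D)) = V / (8 * x * D).
  by rewrite eV eD; field; rewrite ?x0 ?p0 ?x1'.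
have -> : (x ^+ 2 - 1) ^+ 2 / (16 * x ^+ 2)
    * ((X' * (4 * D) - X * (4 * D')) / (4 * D) ^+ 2 * (4 * x ^+ 2 / (x ^+ 2 - 1)))
    = U / (16 * D ^+ 2).
  by rewrite eU; field; rewrite ?x0 ?D0 ?x1'.
transitivity ((x * x * (U * U) + X * D * (V * V)) / (256 * x ^+ 2 * D ^+ 4)).
  by field; rewrite ?x0 ?D0.
rewrite sg /A /B natrD natrM; field.
by rewrite ?x0 ?D0.
Qed.

End Solutions.

Lemma tau_poly0 (S : comNzRingType) (a b : S) : tau_poly 0 a b = 1.
Proof.
rewrite /tau_poly (big_pred1 [ffun=> true]) => [|f]; last by apply/esym/eqP/ffunP => -[].
by rewrite /vand !big_ord0 mulr1 expr0 scale1r.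
Qed.

(** For n = 1 the bracket has no even element, so the polynomial is 1. As M = m + 1, both [A] and
    [B] equal -4(m+1)^2, and 16h is this constant times q + q^-1, which is 2(2t-1). *)
Lemma hfun_linear (R : realType) (m : nat) t : hdom 1 m 0 (m%:R + 1) t ->
  hfun 1 m 0 (m%:R + 1) t = - ((2 * t - 1)%:C * (m%:R + 1 : R[i]) ^+ 2 / 2).
Proof.
move=> ht; have [t1 _ _] := @hdomP R 1 m 0 (m%:R + 1) (or_introl erefl) _ ht.
rewrite (@hfunE R 1 m 0 (m%:R + 1) (or_introl erefl)) //.
have -> : n_even 1 m = 0%N by [].
have -> : n_odd 1 m = m.+1 by rewrite /n_odd /= add0n.
have q0 : (qfun t)%:C != 0 :> R[i] by rewrite real_complex_neq0 // lt0r_neq0 // qfun_gt0.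
rewrite double_t // tau_poly0 /eta_num derivC bin_small // !(mulr0, mulr1, mul0r) subr0 add0r.
rewrite !(horner_nat, hornerD, hornerM, hornerC) !hornerX.
move: (qfun t) q0 => x; rewrite !(realcM, realcD, realcV, realc_nat) -natr1.
by move: x%:C => {}x x0; field.
Qed.

Theorem proposition4 (R : realType) (n m : nat) :
  [/\ (forall b1 b2 : R[i],
         solves_EVI b1 b2 (m%:R + 1 / 2) 0 (hdom 0 m b1 b2) (hfun 0 m b1 b2)),
      (forall t : R, hdom 1 m 0 (m%:R + 1) t ->
         hfun 1 m 0 (m%:R + 1) t
         = - ((2 * t - 1)%:C * (m%:R + 1) ^+ 2 / 2)) /\
      (forall b3 b4 : R[i],
         solves_EVI 0 (m%:R + 1) b3 b4
           (hdom 1 m 0 (m%:R + 1)) (hfun 1 m 0 (m%:R + 1)))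
    & forall b2 : R[i],
        solves_EVI 0 b2 (n%:R / 2) ((n + 2 * m + 1)%:R / 2)
          (hdom n m 0 b2) (hfun n m 0 b2)].
Proof.
(* Once the product of the four parameters vanishes, h' factors out of the left side of E_VI. *)
have lhs (x y u c : R[i]) : c = 0 ->
    x * y ^+ 2 + (x * u + c) ^+ 2 = x * (y ^+ 2 + x * u ^+ 2) by move=> ->; ring.
split.
- move=> b1 b2 t ht /=; have [d1 d2 e] := hfun_sigma (or_intror erefl) ht.
  split=> //; rewrite lhs; last by rewrite mulr0.
  by rewrite e /n_even /n_odd /= add0n; ring.
- split=> [|b3 b4 t ht /=]; first exact: hfun_linear.
  set b := m%:R + 1 in ht *.
  have [t1 _ nH] := @hdomP R 1 m 0 b (or_introl erefl) _ ht.
  have dh x : hdom 1 m 0 b x -> is_cderive (hfun 1 m 0 b) x (- b ^+ 2).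
    move=> hx; have [_ _ nx] := @hdomP R 1 m 0 b (or_introl erefl) _ hx.
    have nh : \forall y \near x, (2 * y - 1)%:C * (- (b ^+ 2 / 2)) = hfun 1 m 0 b y.
      by apply: filterS nx => y hy; rewrite hfun_linear // -/b; ring.
    apply: is_cderive_near nh _.
    have dx : is_derive x 1 (fun y : R => 2 * y - 1) (2 : R).
      apply: is_derive_subc.
      apply: (is_derive_eq (is_derive_mul (is_derive_cst (2 : R) x 1) (is_derive_id x (1 : R)))).
      by rewrite mul0r add0r mulr1.
    apply: is_cderive_eq (is_cderive_mul (is_cderive_real dx) (is_cderive_cst _ x)) _.
    by rewrite mulr0 addr0 realc_nat; field.
  have [d1 e1] := is_cderiveP (dh t ht).
  have n2 : \forall x \near t, - b ^+ 2 = cderive (hfun 1 m 0 b) x.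
    by apply: filterS nH => x hx; have [_ ->] := is_cderiveP (dh x hx).
  have [d2 e2] := is_cderiveP (is_cderive_near n2 (is_cderive_cst _ t)).
  (* Here h'' = 0 and 2h - (2t-1)h' = 0, while h' + b^2 = 0 kills the right side. *)
  split=> //; rewrite e1 e2 hfun_linear // -/b; by field.
- move=> b2 t ht /=; have [d1 d2 e] := hfun_sigma (or_introl erefl) ht.
  split=> //; rewrite lhs; last by rewrite !mul0r.
  (* The parameters M and N + 1/2 are n/2 and (n+2m+1)/2, in this order for even n and in the
     opposite order for odd n. *)
  rewrite e expr0n addr0 /n_even /n_odd.
  have en : n%:R = (odd n)%:R + 2 * n./2%:R :> R[i].
    by rewrite -natrM -natrD mul2n odd_double_half.
  have eM : (n + 2 * m + 1)%:R = n%:R + 2 * m%:R + 1 :> R[i] by rewrite -natrM -natrD natr1 addn1.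
  rewrite eM en; case: (odd n); last by rewrite natrD /= add0r; field.
  by rewrite -[(_ + _).+1%:R]natr1 natrD /=; field.
Qed.
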